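(* Let $T$ be a finite tree with at least $2$ vertices, let $\{S_i\}_{i=1}^k$ be a starlike decomposition of $T$, and let $\ell_i$ be the number of leaves of $S_i$. (a) The number of invariant factors of the critical group of any arithmetical structure on $T$ is at most $\sum_{i=1}^k(\ell_i-2)$. (b) For every integer $t$ with $0\le t\le\sum_{i=1}^k(\ell_i-2)$, there is an arithmetical structure on $T$ whose critical group has exactly $t$ invariant factors.
   Context: For a tree $T$ with adjacency matrix $A(T)$, an arithmetical structure on $T$ is a pair $(\mathbf{d},\mathbf{r})$ with $\mathbf{d}\in\mathbb{Z}_{\ge0}^{V(T)}$, $\mathbf{r}\in\mathbb{Z}_{>0}^{V(T)}$ whose entries have no nontrivial common factor, and $(\operatorname{diag}(\mathbf{d})-A(T))\mathbf{r}=\mathbf{0}$; its critical group is the torsion subgroup of $\mathbb{Z}^{V(T)}/\operatorname{im}(\operatorname{diag}(\mathbf{d})-A(T))$. The number of invariant factors of a finite abelian group is the number of nontrivial cyclic factors in its invariant factor decomposition. A starlike tree is a tree with exactly one vertex of degree at least $3$ (its central vertex). If a tree $T$ has at least two vertices of degree at least $3$, a starlike splitting of $T$ is a $4$-tuple $(S,T',v_s,v_t)$ where $S$ is a starlike tree, $T'$ is a tree, $v_s$ is a leaf of $S$ adjacent to the central vertex of $S$, $v_t\in V(T')$, and $T$ is obtained from $S$ and $T'$ by identifying $v_s$ with $v_t$. A starlike decomposition of a tree $T$ is defined recursively: if $T$ is a starlike tree or a path graph, its only starlike decomposition is $\{T\}$; otherwise, for a starlike splitting $(S_1,T',v_s,v_t)$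 of $T$ and a starlike decomposition $\{S_2,\dots,S_k\}$ of $T'$, the collection $\{S_1,\dots,S_k\}$ is a starlike decomposition of $T$. *)

(* Defs.v *)
From HB Require Import structures.
From mathcomp Require Import all_boot all_order all_fingroup all_algebra.
From mathcomp Require Import all_solvable.
From mathcomp Require Import boolp.

Set Implicit Arguments.
Unset Strict Implicit.
Unset Printing Implicit Defensive.

Import Order.TTheory GRing.Theory Num.Theory.
Local Open Scope ring_scope.

Record sgraph := SGraph {
  vertex :> finType;
  adj : rel vertex;
  adj_sym : symmetric adj;
  adj_irrefl : irreflexive adj }.

Definition nbhd (G : sgraph) (v : G) : {set G} := [set w | adj v w].

Definition deg (G : sgraph) (v : G) : nat := #|nbhd v|.

Definition leaves (G : sgraph) : {set G} := [set v | deg v == 1%N].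

Definition branch_vertices (G : sgraph) : {set G} := [set v | (3 <= deg v)%N].

(* [ucycle] accepts the degenerate cycle [:: x; y] along an edge xy, so a graph
   cycle is a [ucycle] of size at least 3. *)
Definition is_tree (G : sgraph) : Prop :=
  [/\ (0 < #|G|)%N,
      forall x y : G, connect (@adj G) x y
    & forall c : seq G, ucycle (@adj G) c -> (size c <= 2)%N].

Definition is_starlike (G : sgraph) : Prop :=
  is_tree G /\ #|branch_vertices G| = 1%N.

Definition graph_iso (G H : sgraph) : Prop :=
  exists2 f : G -> H, bijective f & {mono f : x y / adj x y}.

Definition path_adj (n : nat) : rel 'I_n :=
  fun i j => (j == i.+1 :> nat) || (i == j.+1 :> nat).

Lemma path_adj_sym n : symmetric (@path_adj n).
Proof. by move=> i j; rewrite /path_adj orbC. Qed.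

Lemma path_adj_irrefl n : irreflexive (@path_adj n).
Proof. by move=> i; rewrite /path_adj orbb; apply/eqP/n_Sn. Qed.

Definition path_graph (n : nat) : sgraph :=
  SGraph (@path_adj_sym n) (@path_adj_irrefl n).

Definition is_path_graph (G : sgraph) : Prop :=
  exists2 n : nat, (0 < n)%N & graph_iso G (path_graph n).

(* The graph obtained from the disjoint union of S and T' by identifying vs
   with vt; the vertex vt of T' represents the identified vertex. *)
Definition glue_adj (S T' : sgraph) (vs : S) (vt : T') :
    rel ({x : S | x != vs} + T')%type :=
  fun u v => match u, v with
  | inl x, inl y => adj (val x) (val y)
  | inl x, inr y => (y == vt) && adj (val x) vs
  | inr x, inl y => (x == vt) && adj vs (val y)
  | inr x, inr y => adj x y
  end.

Lemma glue_adj_sym (S T' : sgraph) (vs : S) (vt : T') :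
  symmetric (@glue_adj S T' vs vt).
Proof. by move=> [x|x] [y|y] /=; rewrite adj_sym. Qed.

Lemma glue_adj_irrefl (S T' : sgraph) (vs : S) (vt : T') :
  irreflexive (@glue_adj S T' vs vt).
Proof. by move=> [x|x] /=; rewrite adj_irrefl. Qed.

Definition glue (S T' : sgraph) (vs : S) (vt : T') : sgraph :=
  SGraph (@glue_adj_sym S T' vs vt) (@glue_adj_irrefl S T' vs vt).

Definition starlike_splitting (T S T' : sgraph) (vs : S) (vt : T') : Prop :=
  [/\ is_tree T /\ (2 <= #|branch_vertices T|)%N,
      is_starlike S,
      is_tree T',
      vs \in leaves S /\ (exists2 c : S, c \in branch_vertices S & adj c vs)
    & graph_iso T (glue vs vt)].

(* Collections of trees are unordered, with repetitions; they are listed here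
   as sequences. *)
Inductive starlike_decomposition : sgraph -> seq sgraph -> Prop :=
| StarlikeBase (T : sgraph) :
    is_tree T -> is_starlike T \/ is_path_graph T ->
    starlike_decomposition T [:: T]
| StarlikeStep (T S T' : sgraph) (vs : S) (vt : T') (Ss : seq sgraph) :
    ~ (is_starlike T \/ is_path_graph T) ->
    starlike_splitting T vs vt ->
    starlike_decomposition T' Ss ->
    starlike_decomposition T (S :: Ss).

(* Vertices index the rows and columns of matrices through [enum_val]. *)
Definition vec (G : sgraph) (f : G -> int) : 'cV[int]_#|G| :=
  \col_i f (enum_val i).

Definition adjmx (G : sgraph) : 'M[int]_#|G| :=
  \matrix_(i, j) (adj (enum_val i) (enum_val j))%:R.

Definition laplacian (G : sgraph) (d : G -> int) : 'M[int]_#|G| :=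
  diag_mx (vec d)^T - adjmx G.

Definition arithmetical_structure (G : sgraph) (d r : G -> int) : Prop :=
  [/\ forall v, 0 <= d v,
      forall v, 0 < r v,
      forall c : int, (forall v, (c %| r v)%Z) -> `|c|%N = 1%N
    & laplacian d *m vec r = 0].

Definition im_mx m n (M : 'M[int]_(m, n)) : {pred 'cV[int]_m} :=
  fun x => `[< exists y : 'cV[int]_n, x = M *m y >].

Lemma im_mxP m n (M : 'M[int]_(m, n)) x :
  reflect (exists y, x = M *m y) (x \in im_mx M).
Proof. exact: asboolP. Qed.

Lemma im_mx_zmod_closed m n (M : 'M[int]_(m, n)) : zmod_closed (im_mx M).
Proof.
split=> [|x y /im_mxP[x' ->] /im_mxP[y' ->]]; apply/im_mxP.
  by exists 0; rewrite mulmx0.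
by exists (x' - y'); rewrite mulmxBr.
Qed.

HB.instance Definition _ m n (M : 'M[int]_(m, n)) :=
  GRing.isZmodClosed.Build 'cV[int]_m (im_mx M) (im_mx_zmod_closed M).

Definition coker_mx m n (M : 'M[int]_(m, n)) : zmodType :=
  Quotient.quot (im_mx M).

Definition torsion (V : zmodType) : {pred V} :=
  fun x => `[< exists2 k : nat, (0 < k)%N & x *+ k = 0 >].
Arguments torsion : clear implicits.

Lemma torsionP (V : zmodType) (x : V) :
  reflect (exists2 k : nat, (0 < k)%N & x *+ k = 0) (x \in torsion V).
Proof. exact: asboolP. Qed.

Lemma torsion_zmod_closed (V : zmodType) : zmod_closed (torsion V).
Proof.
split=> [|x y /torsionP[k k0 xk] /torsionP[l l0 yl]]; apply/torsionP.
  by exists 1%N.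
exists (k * l)%N; first by rewrite muln_gt0 k0.
by rewrite mulrnBl mulrnA xk mul0rn mulnC mulrnA yl mul0rn subrr.
Qed.

HB.instance Definition _ (V : zmodType) :=
  GRing.isZmodClosed.Build V (torsion V) (@torsion_zmod_closed V).

(* The torsion subgroup of Z^n / im M; for M = [laplacian d] this is the
   critical group of the arithmetical structure (d, r). *)
Definition critical_group n (M : 'M[int]_n) :=
  {x : coker_mx M | x \in torsion (coker_mx M)}.

HB.instance Definition _ n (M : 'M[int]_n) := SubChoice.on (critical_group M).
HB.instance Definition _ n (M : 'M[int]_n) :=
  [SubChoice_isSubZmodule of critical_group M by <:].

Lemma coker_eq n (M : 'M[int]_n) (v w : 'cV[int]_n) :
  (\pi_(Quotient.quot (im_mx M)) v == \pi_(Quotient.quot (im_mx M)) w)%qT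
  = (v - w \in im_mx M).
Proof. by rewrite Quotient.idealrBE. Qed.

(* Finiteness of the torsion of the cokernel: if M = L D R is in Smith normal
   form, every torsion class has a representative L u with 0 <= u_i and u_i at
   most the sum of the |D_jj|. *)
Lemma critical_group_enum n (M : 'M[int]_n) :
  exists e : seq (critical_group M), forall x, x \in e.
Proof.
have [L Lu [R Ru [d _ defM]]] := int_Smith_normal_form M.
set D := (\matrix_(i, j) _) in defM.
have DE (z : 'cV[int]_n) i : (D *m z) i ord0 = d`_i * z i ord0.
  rewrite mxE (bigD1 i) //= mxE eqxx mulr1n big1 ?addr0 // => j ji.
  by rewrite mxE eq_sym val_eqE (negPf ji) mulr0n mul0r.
pose N := (\sum_(i < n) absz (d`_i)%R)%N.
pose F (f : {ffun 'I_n -> 'I_N.+1}) : 'cV[int]_n :=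
  L *m \col_i (nat_of_ord (f i))%:Z.
exists [seq insubd (0 : critical_group M)
              (\pi_(Quotient.quot (im_mx M)) (F f))%qT
       | f <- enum {ffun 'I_n -> 'I_N.+1}] => x.
pose v : 'cV[int]_n := generic_quotient.repr (val x : Quotient.quot (im_mx M)).
have xv : val x = (\pi_(Quotient.quot (im_mx M)) v)%qT by rewrite /v reprK.
have /torsionP[k k0 xk] := valP x.
have /im_mxP[y vk] : v *+ k \in im_mx M.
  have := coker_eq M (v *+ k) 0; rewrite subr0 => <-.
  apply/eqP; rewrite [RHS]raddf0 [LHS]raddfMn.
  by rewrite -[RHS]xk xv.
pose w := invmx L *m v.
have vE : v = L *m w by rewrite mulmxA mulmxV // mul1mx.
have wk i : w i ord0 *+ k = d`_i * (R *m y) i ord0.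
  rewrite -DE -mulmxnE; congr (_ i ord0).
  by rewrite /w -raddfMn /= vk defM -!mulmxA mulKmx.
have wd0 (i : 'I_n) : d`_i = 0 -> w i ord0 = 0.
  move=> di0; have /eqP := wk i; rewrite di0 mul0r -mulr_natr mulf_eq0.
  by rewrite pnatr_eq0 (gtn_eqF k0) orbF => /eqP.
have w_ge0 (i : 'I_n) : 0 <= (w i ord0 %% d`_i)%Z.
  have [di0|di0] := eqVneq (d`_i) 0; first by rewrite wd0 // mod0z.
  exact: modz_ge0.
have w_le (i : 'I_n) : (`|(w i ord0 %% d`_i)%Z| < N.+1)%N.
  rewrite ltnS /N (bigD1 i) //= (leq_trans _ (leq_addr _ _)) //.
  have [di0|di0] := eqVneq (d`_i) 0; first by rewrite wd0 // mod0z.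
  rewrite -lez_nat gez0_abs // abszE ltW //; exact: ltz_mod.
apply/mapP; exists [ffun i => inord `|(w i ord0 %% d`_i)%Z|].
  by rewrite mem_enum.
have E : (val x == \pi_(Quotient.quot (im_mx M))
           (F [ffun i => inord `|(w i ord0 %% d`_i)%Z|]))%qT.
  rewrite xv coker_eq; apply/im_mxP.
  exists (invmx R *m \col_i (w i ord0 %/ d`_i)%Z).
  rewrite vE defM -mulmxBr -2!mulmxA; congr (_ *m _).
  rewrite (mulmxA R) mulmxV // mul1mx.
  apply/colP=> i; rewrite DE mxE; move: (w_ge0 i) (w_le i).
  move: w {vE wk wd0 w_ge0 w_le} => w w_ge0 w_le.
  rewrite !mxE ffunE inordK // gez0_abs //.
  by rewrite {1}[w i ord0](divz_eq _ (d`_i)) addrK mulrC.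
apply: val_inj; rewrite insubdK; first exact/eqP.
by rewrite -(eqP E); exact: valP.
Qed.

Definition critical_enum n (M : 'M[int]_n) : seq (critical_group M) :=
  undup (sval (cid (critical_group_enum M))).

Lemma mem_critical_enum n (M : 'M[int]_n) x : x \in critical_enum M.
Proof. by rewrite mem_undup; case: cid. Qed.

Lemma critical_pickleK n (M : 'M[int]_n) :
  pcancel (fun x : critical_group M => index x (critical_enum M)) (onth (critical_enum M)).
Proof.
move=> x; rewrite onthE (nth_map x) ?nth_index ?index_mem //.
all: exact: mem_critical_enum.
Qed.

HB.instance Definition _ n (M : 'M[int]_n) :=
  Choice_isCountable.Build (critical_group M) (@critical_pickleK n M).

Lemma critical_enum_axiom n (M : 'M[int]_n) :
  Finite.axiom (critical_enum M).
Proof.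
by move=> x; rewrite count_uniq_mem ?undup_uniq // mem_critical_enum.
Qed.

HB.instance Definition _ n (M : 'M[int]_n) :=
  isFinite.Build (critical_group M) (@critical_enum_axiom n M).

(* [abelian_type] lists the invariant factors (all > 1, each divisible by the
   next) of a finite abelian group; the group law on a [finZmodType] is +. *)
Definition num_invariant_factors (G : finZmodType) : nat :=
  size (abelian_type [set: G]).

(* Main.v *)
Require Import Defs.
From mathcomp Require Import all_boot all_order all_fingroup all_algebra.
From mathcomp Require Import all_solvable.
From mathcomp Require Import ring zify.

(* For M = diag d - A, sending y to the class of M y / p maps the kernel of M
   modulo p onto the p-torsion of the critical group, and its fibres are the
   translates of the line spanned by r.  So the number of invariant factors is
   the maximum over the primes p of dim ker (M mod p) - 1.

   Upper bound: the support of a kernel vector on a tree reaches two leaves, so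
   a kernel vector vanishing at all but one leaf is zero.  On a gluing of S and
   T', a kernel vector vanishing at all leaves of S except v_s and another one
   vanishes at the centre of S, so it restricts to a kernel vector on T'.

   Lower bound: on a starlike tree with centre c, let r be constant along each
   leg.  If the ratio r_c / r_a is even for the legs in a set A, then modulo 2
   the kernel contains the vectors that vanish at c, are constant along the legs
   in A with sum 0, and vanish elsewhere; it has dimension #|A| - 1.  Such
   structures can be glued, and any value of #|A| between 2 and deg c gives the
   intermediate numbers of invariant factors. *)

Set Implicit Arguments.
Unset Strict Implicit.
Unset Printing Implicit Defensive.

Import Order.TTheory GRing.Theory Num.Theory.
Local Open Scope ring_scope.

(** * Forests *)

Definition acyclic (T : eqType) (e : rel T) : Prop :=
  forall c : seq T, ucycle e c -> (size c <= 2)%N.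

Definition pendant (T : Type) (e : rel T) (v : T) : Prop :=
  exists2 w, e v w & forall u, e v u -> u = w.

Lemma acyclic_sub (T : eqType) (e e' : rel T) :
  subrel e' e -> acyclic e -> acyclic e'.
Proof.
move=> sub_e ac_e c /andP[ec Uc]; apply: ac_e.
by rewrite /ucycle Uc (sub_cycle sub_e ec).
Qed.

(** If [w] lay on the path, the edge from [x] to [w] would close a cycle of length at least 3. *)
Lemma acyclic_path_end (T : eqType) (e : rel T) (x y w : T) (p : seq T) :
    symmetric e -> irreflexive e -> acyclic e ->
    path e x (y :: p) -> uniq (x :: y :: p) -> e x w -> w != y ->
  w \notin x :: y :: p.
Proof.
move=> sym_e irr_e ac_e /= /andP[exy ep] /= Uxyp exw wy.
rewrite !inE (negPf wy) /= negb_or; apply/andP; split.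
  by apply: contraTneq exw => ->; rewrite irr_e.
apply/negP=> wp; case/splitPr: wp ep Uxyp => p1 p2.
rewrite cat_path /= => /and3P[ep1 ew _].
move=> Us; have {Us}: uniq ((x :: y :: rcons p1 w) ++ p2) by rewrite /= cat_rcons.
rewrite cat_uniq => /andP[Uc _].
suff /ac_e : ucycle e [:: x, y & rcons p1 w] by rewrite /= size_rcons.
rewrite /ucycle /= rcons_path last_rcons rcons_path exy ep1 ew sym_e exw /=.
exact: Uc.
Qed.

(* The two ends of a longest simple path are pendant. *)
Lemma acyclic_two_pendants (T : finType) (e : rel T) :
    symmetric e -> irreflexive e -> acyclic e ->
    (exists x y, e x y) ->
  exists x y, [/\ x != y, pendant e x & pendant e y].
Proof.
move=> sym_e irr_e ac_e [x0 [y0 exy0]].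
pose P n := [exists t : n.-tuple T, sorted e t && uniq t].
have P_bound n : P n -> (n <= #|T|)%N.
  by case/existsP=> t /andP[_ /card_uniqP]; rewrite size_tuple => <-; apply: max_card.
have P2 : P 2.
  apply/existsP; exists [tuple x0; y0]; rewrite /= exy0 inE /= andbT.
  by apply: contraTneq exy0 => ->; rewrite irr_e.
case: (ex_maxnP (ex_intro P 2 P2) P_bound) => m /existsP[t /andP[et Ut]] m_max.
have m2 := m_max _ P2.
have long (s : seq T) : sorted e s -> uniq s -> (size s <= m)%N.
  by move=> es Us; apply: m_max; apply/existsP; exists (in_tuple s); rewrite es.
have head_pendant (x y : T) p : size [:: x, y & p] = m ->
    sorted e [:: x, y & p] -> uniq [:: x, y & p] -> pendant e x.
  move=> szm es Us; exists y; first by case/andP: es.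
  move=> w exw; apply/eqP; apply: contraT => wy.
  have wp := acyclic_path_end sym_e irr_e ac_e es Us exw wy.
  have := long [:: w, x, y & p]; rewrite -szm /= ltnn sym_e exw.
  by move=> /(_ es); rewrite wp => /(_ Us).
have sz_t := size_tuple t.
case: {t}(tval t) sz_t et Ut => [|x [|y p]] szm es Us; try by rewrite -szm in m2.
exists x, (last y p); split.
- by apply: contraTneq Us => ->; rewrite /= negb_and negbK mem_last.
- exact: head_pendant szm es Us.
case E : (rev [:: x, y & p]) => [|z [|u q]].
- by move/(congr1 size): E; rewrite size_rev.
- by move/(congr1 size): E; rewrite size_rev.
have -> : last y p = z.
  by rewrite -(last_cons x) -(last_cons x) -[[:: x, y & p]]revK E rev_cons last_rcons.
apply: (head_pendant z u q); rewrite -E ?size_rev ?rev_uniq //.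
by rewrite rev_sorted (eq_sorted (e' := e)).
Qed.

(** * Kernel vectors and gluings *)

(** Keep only the edges that meet the support of [x]. At a pendant vertex of this subforest [x]
    cannot vanish, since the neighbour sum would be a single nonzero term; so all its edges were
    kept and it is pendant in [e] as well. *)
Lemma support_two_pendants (T : finType) (e : rel T) (V : zmodType) (x : T -> V) :
    symmetric e -> irreflexive e -> acyclic e ->
    (forall v, x v = 0 -> \sum_(w | e v w) x w = 0) ->
    (exists u v, e u v /\ x u != 0) ->
  exists u v, [/\ u != v, pendant e u /\ x u != 0 & pendant e v /\ x v != 0].
Proof.
move=> sym_e irr_e ac_e x_sum [u0 [v0 [euv xu0]]].
pose e' u v := e u v && ((x u != 0) || (x v != 0)).
have sym_e' : symmetric e' by move=> u v; rewrite /e' sym_e orbC.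
have irr_e' : irreflexive e' by move=> u; rewrite /e' irr_e.
have ac_e' : acyclic e' by apply: acyclic_sub ac_e => u v /andP[].
have pend v : pendant e' v -> pendant e v /\ x v != 0.
  case=> w /andP[evw xvw] w_uniq; have [xv0|xv0] := eqVneq (x v) 0.
    have := x_sum v xv0; rewrite (bigD1 w) //= big1 => [|u /andP[evu uw]].
      by move/eqP; rewrite addr0; rewrite xv0 eqxx /= in xvw; rewrite (negPf xvw).
    by apply: contraNeq uw => xu; rewrite (w_uniq u) // /e' evu xu orbT.
  by split=> //; exists w => // u evu; apply: w_uniq; rewrite /e' evu xv0.
have [u [v [uv /pend pu /pend pv]]] :
    exists u v, [/\ u != v, pendant e' u & pendant e' v].
  by apply: acyclic_two_pendants => //; exists u0, v0; rewrite /e' euv xu0.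
by exists u, v.
Qed.

(** Keep only the edges along which [x] changes. At a pendant vertex of this subforest the sum of
    differences is one nonzero term, so that vertex is [a]; but a forest with an edge has two
    pendant vertices. *)
Lemma harmonic_forest_const (T : finType) (e : rel T) (V : zmodType)
    (x : T -> V) (a : T) :
    symmetric e -> irreflexive e -> acyclic e ->
    (forall v, v != a -> \sum_(w | e v w) (x v - x w) = 0) ->
  forall u v, e u v -> x u = x v.
Proof.
move=> sym_e irr_e ac_e x_sum u v euv; apply/eqP; apply: contraT => xuv.
pose e' u v := e u v && (x u != x v).
have sym_e' : symmetric e' by move=> ? ?; rewrite /e' sym_e eq_sym.
have irr_e' : irreflexive e' by move=> ?; rewrite /e' irr_e.
have ac_e' : acyclic e' by apply: acyclic_sub ac_e => ? ? /andP[].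
have pend w : pendant e' w -> w = a.
  case=> y /andP[ewy xwy] y_uniq; apply/eqP; apply: contraT => /x_sum.
  rewrite (bigD1 y) //= big1 => [|z /andP[ewz zy]].
    by rewrite addr0 => /eqP; rewrite subr_eq0 (negPf xwy).
  apply/eqP; rewrite subr_eq0; apply: contraNT zy => xwz.
  by rewrite (y_uniq z) // /e' ewz xwz.
have [w [y [wy /pend wa /pend ya]]] :
    exists u v, [/\ u != v, pendant e' u & pendant e' v].
  by apply: acyclic_two_pendants => //; exists u, v; rewrite /e' euv xuv.
by rewrite wa ya eqxx in wy.
Qed.

Lemma tree_acyclic (G : sgraph) : is_tree G -> acyclic (@adj G).
Proof. by case. Qed.

Lemma leafP (G : sgraph) (v : G) : reflect (pendant (@adj G) v) (v \in leaves G).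
Proof.
rewrite inE /deg; apply: (iffP cards1P) => [[w Nv]|[w vw w_uniq]].
  have Nv_in u : adj v u = (u == w) by rewrite -in_set1 -Nv inE.
  by exists w => [|u]; rewrite Nv_in // => /eqP.
exists w; apply/setP=> u; rewrite !inE; apply/idP/eqP => [/w_uniq //|-> //].
Qed.

Lemma tree_has_nbr (G : sgraph) (v : G) :
  is_tree G -> (2 <= #|G|)%N -> exists w, adj v w.
Proof.
move=> [_ conn_G _] /card_gt1P[x [y [_ _ xy]]].
have [w wv] : exists w, w != v.
  by have [xv|] := eqVneq x v; [exists y; rewrite -xv eq_sym|exists x].
case/connectP: (conn_G v w) => [[|u p]] /= => [_ wv'|/andP[vu _] _].
  by rewrite wv' eqxx in wv.
by exists u.
Qed.

Lemma tree_two_leaves (G : sgraph) :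
    is_tree G -> (2 <= #|G|)%N ->
  exists u v, [/\ u != v, u \in leaves G & v \in leaves G].
Proof.
move=> tG G2; have /card_gt0P[x _] := ltnW G2.
have [y xy] := tree_has_nbr x tG G2.
have [|u [v [uv pu pv]]] := acyclic_two_pendants (@adj_sym G) (@adj_irrefl G)
  (tree_acyclic tG); first by exists x, y.
by exists u, v; split=> //; apply/leafP.
Qed.

(* [x] is annihilated by the row of [v] in [diag d - A]. *)
Definition balanced_at (G : sgraph) (R : pzRingType) (d x : G -> R) (v : G) :=
  d v * x v = \sum_(w | adj v w) x w.

Definition balanced (G : sgraph) (R : pzRingType) (d x : G -> R) :=
  forall v, balanced_at d x v.

(** A single [Z] has to work for all fields and all diagonals [d], so that it bounds the kernel of
    every structure modulo every prime. *)
Definition forcing (G : sgraph) (Z : {set G}) : Prop :=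
  forall (F : fieldType) (d x : G -> F), balanced d x ->
  {in Z, forall z, x z = 0} -> forall v, x v = 0.

Lemma forcing_leaves (G : sgraph) (w : G) :
  is_tree G -> (2 <= #|G|)%N -> forcing (leaves G :\ w).
Proof.
move=> tG G2 F d x bal_x x0 v; apply/eqP; apply: contraT => xv.
have [y vy] := tree_has_nbr v tG G2.
have [] := support_two_pendants (x := x) (@adj_sym G) (@adj_irrefl G) (tree_acyclic tG).
- by move=> u xu; rewrite -bal_x xu mulr0.
- by exists v, y.
move=> u [u' [uu' [/leafP lu xu] [/leafP lu' xu']]].
have only_w z : z \in leaves G -> x z != 0 -> z = w.
  by move=> lz; apply: contraNeq => zw; apply/eqP/x0/setD1P.
by rewrite (only_w u) // (only_w u') // eqxx in uu'.
Qed.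

Section Glue.
Variables (S T' : sgraph) (vs : S) (vt : T').
Let G := glue vs vt.

Definition glue_inl (u : S) : glue vs vt :=
  if insub u is Some u' then inl u' else inr vt.

Definition glue_inr (y : T') : glue vs vt := inr y.

(** The value [X vs] is discarded, so vectors are glued under the condition [X vs = x vt]. *)
Definition glue_fun (R : Type) (X : S -> R) (x : T' -> R) (g : glue vs vt) : R :=
  match g with inl u => X (val u) | inr y => x y end.

Lemma glue_left_val (u : S) : u != vs -> exists u' : {u : S | u != vs}, u = val u'.
Proof. by move=> uvs; exists (exist _ u uvs). Qed.

Lemma glue_inlT (u : {u : S | u != vs}) : glue_inl (val u) = inl u.
Proof. by rewrite /glue_inl valK. Qed.

Lemma glue_inlF : glue_inl vs = inr vt.
Proof. by rewrite /glue_inl insubF ?eqxx. Qed.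

Lemma glue_funl (R : Type) (X : S -> R) (x : T' -> R) u :
  X vs = x vt -> glue_fun X x (glue_inl u) = X u.
Proof.
move=> Xx; have [->|uvs] := eqVneq u vs; first by rewrite glue_inlF.
by have [u' ->] := glue_left_val uvs; rewrite glue_inlT.
Qed.

Lemma glue_sum_inl (V : nmodType) (x : G -> V) (u : {u : S | u != vs}) :
  \sum_(w | @adj G (inl u) w) x w = \sum_(w | adj (val u) w) x (glue_inl w).
Proof.
rewrite [LHS]big_sumType /= [RHS](bigID (fun w => w != vs)) /=.
congr (_ + _).
  rewrite (eq_bigl (fun w => (w != vs) && adj (val u) w)); last by move=> w; rewrite andbC.
  rewrite (big_sub_cond (fun w => w != vs)); apply: eq_bigr => w _.
  by rewrite glue_inlT.
rewrite (eq_bigl (fun y => (y == vt) && adj (val u) vs)) //.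
rewrite [RHS](eq_bigl (fun w => (w == vs) && adj (val u) vs)).
  rewrite !big_mkcondr !big_pred1_eq; case: ifP => // _.
  by rewrite glue_inlF.
by move=> w; rewrite negbK andbC; case: eqVneq => [->|].
Qed.

Lemma glue_sum_inr (V : nmodType) (x : G -> V) (y : T') :
  \sum_(w | @adj G (inr y) w) x w =
  \sum_(w | adj y w) x (glue_inr w) +
  (if y == vt then \sum_(w | adj vs w) x (glue_inl w) else 0).
Proof.
rewrite [LHS]big_sumType /= addrC; congr (_ + _).
case: eqP => _ /=; last by rewrite big_pred0.
rewrite [RHS](eq_bigl (fun w => (w != vs) && adj vs w)).
  rewrite (big_sub_cond (fun w => w != vs)); apply: eq_bigr => w _.
  by rewrite glue_inlT.
by move=> w; case: eqVneq => [->|]; rewrite ?adj_irrefl.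
Qed.

Lemma glue_balanced_inl (R : pzRingType) (d x : G -> R) (u : S) :
    u != vs -> balanced_at d x (glue_inl u) ->
  balanced_at (d \o glue_inl) (x \o glue_inl) u.
Proof.
move=> /glue_left_val[u' ->]; rewrite /balanced_at /= glue_inlT.
by rewrite glue_sum_inl.
Qed.

End Glue.

(** * Zero forcing sets *)

Lemma leaf_nbr (G : sgraph) (v c u : G) : v \in leaves G -> adj c v -> adj u v = (u == c).
Proof.
case/leafP=> w vw w_uniq cv.
have cw : c = w by apply: w_uniq; rewrite adj_sym.
apply/idP/eqP => [uv|-> //]; rewrite cw; apply: w_uniq; by rewrite adj_sym.
Qed.

Lemma leaf_sum (G : sgraph) (V : nmodType) (x : G -> V) (v c : G) :
  v \in leaves G -> adj c v -> \sum_(w | adj v w) x w = x c.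
Proof.
move=> lv cv; rewrite (big_pred1 c) // => u.
by rewrite adj_sym (leaf_nbr u lv cv).
Qed.

Lemma branch_nbr_neq2 (G : sgraph) (c a b : G) :
  c \in branch_vertices G -> exists w, [/\ adj c w, w != a & w != b].
Proof.
rewrite inE => deg_c; have: (0 < #|nbhd c :\: [set a; b]|)%N.
  rewrite cardsD subn_gt0 (leq_ltn_trans _ deg_c) //.
  by rewrite (leq_trans (subset_leq_card (subsetIr _ _))) // cards2; case: eqP.
by case/card_gt0P=> w; rewrite !inE negb_or -andbA => /and3P[wa wb cw]; exists w.
Qed.

(* If [x] is nonzero at the centre [c], then removing [vs] leaves a forest in
   which the support of [x] reaches two leaves other than [vs]. *)
Lemma balanced_center_eq0 (S : sgraph) (vs c w : S) (F : fieldType) (d x : S -> F) :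
    is_tree S -> vs \in leaves S -> c \in branch_vertices S -> adj c vs ->
    (forall u, u != vs -> balanced_at d x u) ->
    {in leaves S :\ vs :\ w, forall z, x z = 0} ->
  x c = 0.
Proof.
move=> tS lvs bc cvs bal_x x0; apply/eqP; apply: contraT => xc.
pose e u v := [&& adj u v, u != vs & v != vs].
have c_vs : c != vs by apply: contraTneq cvs => ->; rewrite adj_irrefl.
have sym_e : symmetric e by move=> u v; rewrite /e adj_sym [(u != vs) && _]andbC.
have irr_e : irreflexive e by move=> u; rewrite /e adj_irrefl.
have ac_e : acyclic e by apply: acyclic_sub (tree_acyclic tS) => u v /andP[].
(* The leaf [vs] meets only [c], so removing it changes the neighbours of [c] alone. *)
have eE u v : u != vs -> u != c -> e u v = adj u v.
  move=> uvs uc; rewrite /e uvs /=; have [->|_] := eqVneq v vs; last exact: andbT.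
  by rewrite andbF (leaf_nbr u lvs cvs) (negPf uc).
have [a [ca avs _]] := branch_nbr_neq2 vs vs bc.
have [] := support_two_pendants (x := x) sym_e irr_e ac_e.
- move=> u xu; have [->|uvs] := eqVneq u vs.
    by rewrite big_pred0 // => v; rewrite /e eqxx andbF.
  have uc : u != c by apply: contra_eq_neq xu => ->.
  by rewrite (eq_bigl _ _ (fun v => eE u v uvs uc)) -bal_x // xu mulr0.
- by exists c, a; rewrite /e ca avs c_vs.
have only_w u : pendant e u -> x u != 0 -> u = w.
  case=> y /and3P[uy uvs yvs] y_uniq; apply: contraNeq => uw; apply/eqP/x0.
  rewrite in_setD1 uw in_setD1 uvs; apply/leafP; exists y => // z uz.
  (* The centre is not pendant in [e]: having degree at least 3, it keeps a neighbour besides [vs]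
     and [y]. *)
  have [uc|uc] := eqVneq u c; last by apply: y_uniq; rewrite eE.
  have [b [cb bvs bya]] := branch_nbr_neq2 vs y bc.
  by rewrite (y_uniq b) ?eqxx // /e uc cb c_vs in bya.
move=> u [v [uv [pu xu] [pv xv]]].
by rewrite (only_w u) // (only_w v) // eqxx in uv.
Qed.

Lemma forcing_glue (S T' : sgraph) (vs c w : S) (vt : T') (Z' : {set T'}) :
    is_tree S -> vs \in leaves S -> c \in branch_vertices S -> adj c vs ->
    w \in leaves S -> w != vs -> forcing Z' ->
  forcing (glue_inl vs vt @: (leaves S :\ vs :\ w) :|: glue_inr vs vt @: Z').
Proof.
move=> tS lvs bc cvs lw wvs forceZ' F d x bal_x x0.
pose X := x \o glue_inl vs vt; pose D := d \o glue_inl vs vt.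
have X0 : {in leaves S :\ vs :\ w, forall z, X z = 0}.
  by move=> z Zz; apply: x0; rewrite inE imset_f.
have balX u : u != vs -> balanced_at D X u.
  by move=> uvs; apply: glue_balanced_inl.
have Xc : x (glue_inl vs vt c) = 0 := balanced_center_eq0 tS lvs bc cvs balX X0.
(* The centre is the only neighbour of [vs] in [S]; as [x] is zero there, the balance at [vt] is
   that of [T'] alone. *)
have x'0 : forall y, x (glue_inr vs vt y) = 0.
  apply: (forceZ' F (d \o glue_inr vs vt)) => [y|z Zz]; last first.
    by apply: x0; rewrite inE imset_f ?orbT.
  rewrite /balanced_at /= bal_x glue_sum_inr.
  by case: eqP => _; rewrite ?(leaf_sum _ lvs cvs) ?Xc addr0.
have Xvs : X vs = 0 by rewrite /X /= glue_inlF; apply: x'0.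
have S2 : (2 <= #|S|)%N by apply/card_gt1P; exists w, vs.
case=> [u|y]; last exact: x'0.
(* Since [X] vanishes at [vs] and at [c], its row at [vs] holds too, and [w] is the only leaf of [S]
   where [X] is not yet known to vanish. *)
rewrite -glue_inlT; apply: (@forcing_leaves S w tS S2 F D X _ _ (val u)) => [v|z].
  have [->|] := eqVneq v vs; last exact: balX.
  by rewrite /balanced_at Xvs mulr0 (leaf_sum _ lvs cvs) [RHS]Xc.
rewrite in_setD1 => /andP[zw lz]; have [->|zvs] := eqVneq z vs; first exact: Xvs.
by apply: X0; rewrite in_setD1 zw in_setD1 zvs.
Qed.

Lemma card_forcing_glue (S T' : sgraph) (vs w : S) (vt : T') (Z' : {set T'}) :
    vs \in leaves S -> w \in leaves S -> w != vs ->
  (#|glue_inl vs vt @: (leaves S :\ vs :\ w) :|: glue_inr vs vt @: Z'|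
     <= #|leaves S| - 2 + #|Z'|)%N.
Proof.
move=> lvs lw wvs; apply: leq_trans (leq_card_setU _ _) _.
apply: leq_add; last exact: leq_imset_card.
apply: leq_trans (leq_imset_card _ _) _.
rewrite (cardsD1 vs (leaves S)) lvs (cardsD1 w (leaves S :\ vs)).
by rewrite in_setD1 wvs lw !add1n subSS subSS subn0.
Qed.

(** * Transport along graph isomorphisms *)

Section Iso.
Variables (G H : sgraph) (f : G -> H).
Hypotheses (bij_f : bijective f) (mono_f : {mono f : x y / adj x y}).

Lemma iso_sum (V : nmodType) (x : H -> V) (v : G) :
  \sum_(w | adj (f v) w) x w = \sum_(w | adj v w) x (f w).
Proof.
rewrite (reindex f); last exact: onW_bij.
by apply: eq_bigl => w; rewrite mono_f.
Qed.

Lemma iso_balanced_at (R : pzRingType) (d x : H -> R) (v : G) :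
  balanced_at d x (f v) <-> balanced_at (d \o f) (x \o f) v.
Proof. by rewrite /balanced_at iso_sum. Qed.

Lemma iso_card_preim (Z : {set H}) : #|f @^-1: Z| = #|Z|.
Proof. exact/on_card_preimset/onW_bij. Qed.

Lemma iso_deg (v : G) : deg (f v) = deg v.
Proof.
rewrite /deg -(iso_card_preim (nbhd _)); apply: eq_card => w.
by rewrite !inE mono_f.
Qed.

Lemma iso_card_branch : #|branch_vertices H| = #|branch_vertices G|.
Proof.
rewrite -iso_card_preim; apply: eq_card => v; by rewrite !inE iso_deg.
Qed.

Lemma iso_forcing (Z : {set H}) : forcing Z -> forcing (f @^-1: Z).
Proof.
have [g fK gK] := bij_f; move=> forceZ F d x bal_x x0 v.
rewrite -(fK v); apply: (forceZ F (d \o g) (x \o g)) => [y|z Zz].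
  by rewrite -(gK y) iso_balanced_at; rewrite /balanced_at /= fK bal_x;
     apply: eq_bigr => w _; rewrite /= fK.
by apply: x0; rewrite inE /= gK.
Qed.
End Iso.

(** * Gluing of structures *)

Definition intr_fun (T : Type) (R : pzRingType) (d : T -> int) : T -> R :=
  fun v => (d v)%:~R.

(* [Z] witnesses that the kernel of [diag d - A] has dimension #|Z| modulo 2
   and at most #|Z| modulo every other prime. *)
Definition sharp (G : sgraph) (d : G -> int) (Z : {set G}) : Prop :=
  [/\ forall v, 0 <= d v,
      exists2 r : G -> int, forall v, 0 < r v & balanced d r,
      forall p, prime p -> forall x : G -> 'F_p, balanced (intr_fun _ d) x ->
        {in Z, forall z, x z = 0} -> forall v, x v = 0
    & forall z0, z0 \in Z -> exists2 x : G -> 'F_2,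
        balanced (intr_fun _ d) x & {in Z, forall z, x z = (z == z0)%:R}].

Lemma eq_balanced (G : sgraph) (R : pzRingType) (d d' x : G -> R) :
  d =1 d' -> balanced d x -> balanced d' x.
Proof. by move=> dd' bal_x v; rewrite /balanced_at -dd'; apply: bal_x. Qed.

Lemma sum_nbr_const (G : sgraph) (R : pzRingType) (a : R) (v : G) :
  \sum_(w | adj v w) a = (deg v)%:R * a.
Proof.
rewrite sumr_const mulr_natl; congr (_ *+ _); apply: eq_card => w.
by rewrite /nbhd inE.
Qed.

Lemma connect_const (T : finType) (e : rel T) (V : eqType) (x : T -> V) (u v : T) :
    (forall y z, connect e u y -> e y z -> x y = x z) ->
  connect e u v -> x v = x u.
Proof.
move=> x_const /connectP[p ep ->] {v}; elim/last_ind: p ep => [|p z IHp] //=.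
rewrite rcons_path last_rcons => /andP[ep ez]; rewrite -(IHp ep); apply/esym.
by apply: x_const ez; apply/connectP; exists p.
Qed.

(** The diagonal of degrees gives the ordinary Laplacian, whose kernel on a tree consists of the
    constants modulo every prime. It serves for paths. *)
Lemma sharp_laplacian (G : sgraph) (a : G) :
  is_tree G -> sharp (fun v : G => (deg v)%:Z) [set a].
Proof.
move=> tG; have bal1 (R : pzRingType) :
    balanced (intr_fun R (fun v : G => (deg v)%:Z)) (fun=> 1).
  by move=> v; rewrite /balanced_at sum_nbr_const.
split=> //.
- by exists (fun=> 1) => // v; rewrite /balanced_at sum_nbr_const natz.
- move=> p _ x bal_x x0 v; have [_ conn_G _] := tG.
  rewrite -(x0 a (set11 a)); apply: connect_const (conn_G a v) => y z _ yz.
  apply: (harmonic_forest_const (a := a) (@adj_sym G) (@adj_irrefl G)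
    (tree_acyclic tG)) yz => u _.
  by rewrite sumrB sum_nbr_const -bal_x subrr.
- move=> z0 /set1P->; exists (fun=> 1); first exact: bal1.
  by move=> z /set1P->; rewrite eqxx.
Qed.

Section SharpGlue.
Variables (S T' : sgraph) (vs : S) (vt : T').

(** The row of the identified vertex is the sum of the rows of [vs] and [vt], hence the two diagonal
    entries add up there. *)
Definition glue_diag (R : nmodType) (D : S -> R) (d' : T' -> R) : glue vs vt -> R :=
  glue_fun D (fun y => d' y + (if y == vt then D vs else 0)).

Lemma balanced_glue (R : pzRingType) (D X : S -> R) (d' x' : T' -> R) :
    balanced D X -> balanced d' x' -> X vs = x' vt ->
  balanced (glue_diag D d') (glue_fun X x').
Proof.
move=> balX balx Xx [u|y]; rewrite /balanced_at.
  rewrite glue_sum_inl /= balX; apply: eq_bigr => w _.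
  by rewrite glue_funl.
rewrite glue_sum_inr /= mulrDl balx; congr (_ + _).
case: eqP => [->|]; last by rewrite mul0r.
by rewrite -Xx balX; apply: eq_bigr => w _; rewrite glue_funl.
Qed.

(** The identified vertex provides only the sum of the equations at [vs] and [vt]. The hypothesis on
    [D] recovers the equation at [vs] from the other vertices of [S], and subtraction leaves the one
    at [vt]. *)
Lemma balanced_unglue (R : pzRingType) (D : S -> R) (d' : T' -> R) (x : glue vs vt -> R) :
    (forall X : S -> R, (forall u, u != vs -> balanced_at D X u) -> balanced_at D X vs) ->
    balanced (glue_diag D d') x ->
  balanced D (x \o glue_inl vs vt) /\ balanced d' (x \o glue_inr vs vt).
Proof.
move=> extD bal_x; set X := _ \o _; set x' := _ \o _.
have balX u : u != vs -> balanced_at D X u.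
  move=> uvs; have := glue_balanced_inl uvs (bal_x _); rewrite /X /balanced_at /=.
  by have [u' ->] := glue_left_val uvs; rewrite glue_inlT /=.
have balXvs := extD X balX; split=> [u|y].
  by have [->|/balX] := eqVneq u vs.
have := bal_x (inr y); rewrite /balanced_at glue_sum_inr /= mulrDl.
case: eqP => [->|_]; last by rewrite mul0r !addr0.
have -> : D vs * x (inr vt) = \sum_(w | adj vs w) x (glue_inl vs vt w).
  by rewrite -(glue_inlF vs vt); apply: balXvs.
by move/addIr.
Qed.

(** Modulo a prime, the kernel vectors of the gluing are the pairs of kernel vectors that agree at
    the identified vertex. The coordinate [vs] is dropped from [ZS] because the vector on [T']
    determines it. *)
Lemma sharp_glue (D : S -> int) (ZS : {set S}) (d' : T' -> int) (Z' : {set T'}) :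
    vs \in ZS ->
    (forall p, prime p -> forall X : S -> 'F_p,
       (forall u, u != vs -> balanced_at (intr_fun _ D) X u) ->
       balanced_at (intr_fun _ D) X vs) ->
    sharp D ZS -> sharp d' Z' ->
  sharp (glue_diag D d') (glue_inl vs vt @: (ZS :\ vs) :|: glue_inr vs vt @: Z').
Proof.
move=> ZSvs extD [D_ge0 [rS rS_gt0 bal_rS] ubS lbS] [d_ge0 [r' r_gt0 bal_r'] ub' lb'].
have diagE R : glue_diag (intr_fun R D) (intr_fun R d') =1 intr_fun R (glue_diag D d').
  case=> [u|y] //=; rewrite /intr_fun /= intrD; by case: eqP.
split.
- by case=> [u|y] /=; rewrite ?addr_ge0 //; case: eqP.
(* Each vector is scaled by the value of the other at the identified vertex, so that the two agree
   there. *)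
- exists (glue_fun (fun u => rS u * r' vt) (fun y => rS vs * r' y)).
    by case=> [u|y] /=; rewrite mulr_gt0.
  apply: balanced_glue => // [u|y]; rewrite /balanced_at.
    by rewrite mulrA bal_rS mulr_suml.
  by rewrite mulrCA bal_r' mulr_sumr.
- move=> p p_pr x bal_x x0.
  have [|balX balx] := balanced_unglue (extD p p_pr) (d' := intr_fun _ d') (x := x).
    by apply: eq_balanced bal_x => g; rewrite diagE.
  have x'0 y : x (glue_inr vs vt y) = 0.
    by apply: (ub' p p_pr _ balx) => z Zz; apply: x0; rewrite inE imset_f ?orbT.
  case=> [u|y]; last exact: x'0.
  rewrite -glue_inlT; apply: (ubS p p_pr _ balX) => z Zz /=.
  have [->|zvs] := eqVneq z vs; first by rewrite glue_inlF; apply: x'0.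
  by apply: x0; rewrite inE imset_f // in_setD1 zvs.
- move=> z0; rewrite inE => /orP[] /imsetP[z].
    rewrite in_setD1 => /andP[zvs Zz] -> {z0}; have [X balX XE] := lbS z Zz.
    have Xvs : X vs = 0 by rewrite XE // eq_sym (negPf zvs).
    (* A vector of [S] vanishing at [vs] extends by zero. *)
    exists (glue_fun X (fun=> 0)).
      apply: eq_balanced (diagE _) _; apply: balanced_glue => // y.
      by rewrite /balanced_at mulr0 big1.
    have [z' zE] := glue_left_val zvs; rewrite zE glue_inlT.
    move=> g; rewrite inE => /orP[] /imsetP[y Zy ->] //.
    move: Zy; rewrite in_setD1 => /andP[yvs Zy].
    rewrite glue_funl // XE //; have [y' ->] := glue_left_val yvs.
    by rewrite glue_inlT zE.
  move=> Zz -> {z0}; have [x' balx x'E] := lb' z Zz.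
  have [X balX XE] := lbS vs ZSvs.
  have Xvs : X vs * x' vt = x' vt by rewrite XE // eqxx mul1r.
  (* The vector of [S] that is 1 at [vs] and 0 on the rest of [ZS] carries [x'] across the
     gluing. *)
  exists (glue_fun (fun u => X u * x' vt) x').
    apply: eq_balanced (diagE _) _; apply: balanced_glue => // u.
    by rewrite /balanced_at mulrA balX mulr_suml.
  move=> g; rewrite inE => /orP[] /imsetP[y Zy ->]; last exact: x'E.
  move: Zy; rewrite in_setD1 => /andP[yvs Zy].
  rewrite glue_funl // XE // (negPf yvs) mul0r.
  by have [y' ->] := glue_left_val yvs; rewrite glue_inlT.
Qed.

Lemma card_sharp_glue (ZS : {set S}) (Z' : {set T'}) : vs \in ZS ->
  #|glue_inl vs vt @: (ZS :\ vs) :|: glue_inr vs vt @: Z'| = (#|ZS|.-1 + #|Z'|)%N.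
Proof.
move=> ZSvs; rewrite cardsU disjoint_setI0 ?cards0 ?subn0.
  rewrite [in RHS](cardsD1 vs ZS) ZSvs /=; congr (_ + _)%N.
    apply: card_in_imset => u v; rewrite !in_setD1 => /andP[uvs _] /andP[vvs _].
    have [u' ->] := glue_left_val uvs; have [v' ->] := glue_left_val vvs.
    by rewrite !glue_inlT => -[->].
  by apply: card_imset => u v [].
rewrite -setI_eq0; apply/eqP/setP=> g; rewrite !inE; apply/andP=> -[].
case/imsetP=> u; rewrite in_setD1 => /andP[uvs _] -> /imsetP[y _].
by have [u' ->] := glue_left_val uvs; rewrite glue_inlT.
Qed.

End SharpGlue.

Lemma iso_sharp (G H : sgraph) (f : G -> H) (d : H -> int) (Z : {set H}) :
    bijective f -> {mono f : x y / adj x y} ->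
  sharp d Z -> sharp (d \o f) (f @^-1: Z).
Proof.
move=> bij_f mono_f; have [g fK gK] := bij_f.
have bal_g (R : pzRingType) (d' : H -> R) (x : G -> R) :
    balanced (d' \o f) x -> balanced d' (x \o g).
  move=> bal_x y; rewrite -(gK y); apply/(iso_balanced_at bij_f mono_f).
  rewrite /balanced_at /= fK bal_x; apply: eq_bigr => w _; by rewrite /= fK.
case=> d_ge0 [r r_gt0 bal_r] ub lb; split=> [v||p p_pr x bal_x x0 v|z0].
- exact: d_ge0.
- exists (r \o f) => [v|v]; first exact: r_gt0.
  exact/(iso_balanced_at bij_f mono_f).
- rewrite -(fK v); apply: (ub p p_pr (x \o g)) => [|z Zz].
    exact: bal_g.
  by apply: x0; rewrite inE gK.
rewrite inE => /lb[x bal_x xE]; exists (x \o f) => [v|z].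
  exact/(iso_balanced_at bij_f mono_f (intr_fun _ d) x).
by rewrite inE /= => /xE ->; rewrite (can_eq fK).
Qed.

(** * Structures on starlike trees *)

Section Centre.
Variables (S : sgraph) (c : S).
Hypothesis tS : is_tree S.

Definition off_adj (u v : S) := [&& adj u v, u != c & v != c].
(** The legs are the components of [S] without [c], each named by a canonical representative; [c] is
    isolated for [off_adj]. *)
Definition leg (v : S) : S := fingraph.root off_adj v.

Lemma off_adj_sym : symmetric off_adj.
Proof. by move=> u v; rewrite /off_adj adj_sym [(u != c) && _]andbC. Qed.

Lemma off_adj_irrefl : irreflexive off_adj.
Proof. by move=> u; rewrite /off_adj adj_irrefl. Qed.

Lemma leg_eqP (u v : S) : reflect (leg u = leg v) (connect off_adj u v).
Proof. exact/fingraph.rootP/sym_connect_sym/off_adj_sym. Qed.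

Lemma off_adj_leg (u v : S) : off_adj u v -> leg u = leg v.
Proof. by move=> uv; apply/leg_eqP/connect1. Qed.

(** Two neighbours of [c] joined off [c] would close a cycle through [c]. *)
Lemma leg_inj : {in nbhd c &, injective leg}.
Proof.
move=> u v; rewrite !inE => cu cv /leg_eqP/connectP[p0 ep0 vE]; move: cv; rewrite {v}vE.
case/shortenP: ep0 => p ep Up _ cv.
have [->//|p_neq0] := eqVneq p [::].
have cp : c \notin u :: p.
  rewrite inE negb_or; apply/andP; split.
    by apply: contraTneq cu => <-; rewrite adj_irrefl.
  have: all (fun v => v != c) p.
    elim: (p) (u) ep => //= y q IHq z /andP[/and3P[_ _ ->]]; exact: IHq.
  by move/allP=> p_c; apply: contraT => /negPn/p_c; rewrite eqxx.
have := @tree_acyclic _ tS [:: c, u & p].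
rewrite /ucycle; case: p p_neq0 ep Up cv cp => // y p _ ep Up cv cp.
suff -> : path.cycle (@adj S) [:: c, u, y & p] && uniq [:: c, u, y & p].
  by move=> /(_ isT).
rewrite (cons_uniq c) cp Up andbT.
have sub_off : subrel off_adj (@adj S) by move=> ? ? /andP[].
have -> : path.cycle (@adj S) [:: c, u, y & p] =
    adj c u && path (@adj S) u (rcons (y :: p) c) by [].
by rewrite cu rcons_path (sub_path sub_off ep) adj_sym cv.
Qed.

(** A simple path from [c] to [v] never returns to [c], so after its first step it stays on one
    leg. *)
Lemma leg_cover (v : S) : v != c -> exists2 u, adj c u & leg u = leg v.
Proof.
move=> vc; have [_ conn_S _] := tS.
have /connectP[p0 ep0 vE] := conn_S c v; move: vc; rewrite vE.
case/shortenP: ep0 => [[|u p] ep Up _] /=; first by rewrite eqxx.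
move=> _; case/andP: ep => cu ep; exists u => //.
case/andP: Up => cp _; apply/leg_eqP/connectP; exists p => //.
have: all (fun v => v != c) (u :: p).
  by apply/allP=> w wp; apply: contraNneq cp => <-.
elim: p u ep {cu cp} => //= y p IHp u /andP[uy ep] /and3P[uc yc pc].
by rewrite /off_adj uy uc yc IHp //= yc.
Qed.

(** All the neighbours of [v] other than [c] lie on its leg; the boolean [adj c v] counts the
    possible neighbour [c]. *)
Lemma leg_sum (R : pzRingType) (x : S -> R) (v : S) :
    v != c -> (forall w, off_adj v w -> x w = x v) ->
  \sum_(w | adj v w) x w = (deg v - adj c v)%:R * x v + (if adj c v then x c else 0).
Proof.
move=> vc x_const; have offE w : w != c -> adj v w = off_adj v w.
  by move=> wc; rewrite /off_adj vc wc !andbT.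
have sum_off : \sum_(w | adj v w && (w != c)) x w = \sum_(w | adj v w && (w != c)) x v.
  by apply: eq_bigr => w /andP[vw wc]; rewrite x_const // -offE.
have := sum_nbr_const (x v) v; rewrite [adj c v]adj_sym.
have [vc_adj|vc_adj] := ifPn (adj v c).
  rewrite !(bigD1 c vc_adj) /= sum_off => E; rewrite [RHS]addrC; congr (_ + _).
  have deg_gt0 : (1 <= deg v)%N by apply/card_gt0P; exists c; rewrite inE.
  by rewrite natrB // mulrBl mul1r -E addrC addrK.
rewrite subn0 addr0 => <-; rewrite (eq_bigl (fun w => adj v w && (w != c))).
  rewrite sum_off; apply: eq_bigl.
all: move=> w; by have [->|] := eqVneq w c; rewrite ?andbT ?(negPf vc_adj).
Qed.

Section Weights.
Variables (A : {set S}) (a b : S).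
Hypotheses (sub_A : A \subset nbhd c) (Aa : a \in A) (Ab : b \in A) (ab : a != b).

Definition on_leg (v : S) : bool := leg v \in leg @: A.
Definition on_end (v : S) : bool := (leg v == leg a) || (leg v == leg b).

(* [div_weight] is [r_c / r_v] along a leg and [leg_weight] is [r_v], scaled so
   that [r_c = 4].  The sum of the values at the neighbours of [c] must be
   divisible by 4, which is what the parity test ensures. *)
Definition div_weight (v : S) : nat :=
  if on_end v then (if odd #|A| then 4 else 2) else if on_leg v then 2 else 1.
Definition leg_weight (v : S) : nat :=
  if v == c then 4
  else if on_end v then (if odd #|A| then 1 else 2) else if on_leg v then 2 else 4.

(** The diagonal for which [leg_weight] is a kernel vector. Along a leg the weight is constant,
    which gives the degree; next to [c] the neighbour [c] counts [div_weight] times instead of once;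
    at [c] the neighbour sum is divided by the weight 4 of [c]. *)
Definition star_diag (v : S) : nat :=
  if v == c then ((\sum_(u | adj c u) leg_weight u) %/ 4)%N
  else (deg v - adj c v + adj c v * div_weight v)%N.

Lemma nbr_neq (u : S) : adj c u -> u != c.
Proof. by apply: contraTneq => ->; rewrite adj_irrefl. Qed.

Lemma mem_A_adj (u : S) : u \in A -> adj c u.
Proof. by move/(subsetP sub_A); rewrite inE. Qed.

Lemma leg_eq_nbr (u v : S) : adj c u -> adj c v -> (leg u == leg v) = (u == v).
Proof.
by move=> cu cv; apply/eqP/eqP => [|-> //]; apply: leg_inj; rewrite inE.
Qed.

Lemma on_leg_nbr (u : S) : adj c u -> on_leg u = (u \in A).
Proof.
move=> cu; apply/imsetP/idP => [[v Av /leg_inj->//]|Au]; last by exists u.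
  by rewrite inE.
exact: (subsetP sub_A).
Qed.

Lemma div_weight_even (v : S) : on_leg v -> ~~ odd (div_weight v).
Proof. by rewrite /div_weight => ->; case: ifP => //; case: ifP. Qed.

Lemma weightM (v : S) : v != c -> (leg_weight v * div_weight v = 4)%N.
Proof.
move=> vc; rewrite /leg_weight /div_weight (negPf vc).
by case: ifP => _; case: ifP.
Qed.

(** Neighbours outside [A] weigh 4 each. Those in [A] together weigh [2 * #|A|] when [#|A|] is even,
    and [2 * (#|A| - 1)] when it is odd, since [a] and [b] then weigh 1 each. *)
Lemma leg_weight_nbr_sum : (4 %| \sum_(u | adj c u) leg_weight u)%N.
Proof.
have ca := mem_A_adj Aa; have cb := mem_A_adj Ab.
have end_nbr u : adj c u -> on_end u = (u == a) || (u == b).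
  by move=> cu; rewrite /on_end !leg_eq_nbr.
have ba : b != a by rewrite eq_sym.
have A2 : (2 <= #|A|)%N by apply/card_gt1P; exists a, b.
rewrite (bigID (mem A)) /= dvdn_addl; last first.
  apply: dvdn_sum => u /andP[cu Au].
  rewrite /leg_weight (negPf (nbr_neq cu)) on_leg_nbr // (negPf Au) end_nbr //.
  by case: eqVneq Au => [->|_]; rewrite ?Aa //; case: eqVneq => [->|]; rewrite ?Ab.
rewrite (eq_bigl (mem A)); last first.
  by move=> u /=; apply: andb_idl; apply: mem_A_adj.
rewrite (bigD1 a) //= (bigD1 b) ?Ab ?ba //=.
rewrite (eq_bigr (fun=> 2%N)) => [|u /andP[/andP[Au ua] ub]]; last first.
  have cu := mem_A_adj Au; rewrite /leg_weight (negPf (nbr_neq cu)) end_nbr //.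
  by rewrite (negPf ua) (negPf ub) on_leg_nbr // Au.
rewrite sum_nat_cond_const (_ : #|_| = #|A| - 2)%N; last first.
  rewrite (cardsD1 a A) Aa (cardsD1 b (A :\ a)) in_setD1 ba Ab !addnA addKn.
  apply: eq_card => u; rewrite !inE.
  by case: (u \in A); case: (u == a); case: (u == b).
rewrite /leg_weight !(negPf (nbr_neq _)) // !end_nbr // !eqxx orbT /=.
have [hA|hA] := ifPn (odd #|A|); lia.
Qed.

Let D := fun v => (star_diag v)%:Z.

Lemma star_diag_leg (v : S) : v != c ->
  star_diag v = (deg v - adj c v + adj c v * div_weight v)%N.
Proof. by rewrite /star_diag => /negPf->. Qed.

Lemma off_weight (u v : S) : off_adj u v -> leg_weight u = leg_weight v.
Proof.
move=> uv; have /and3P[_ uc vc] := uv.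
by rewrite /leg_weight /on_end /on_leg (negPf uc) (negPf vc) (off_adj_leg uv).
Qed.

Lemma balanced_leg_weight : balanced D (fun v => (leg_weight v)%:Z).
Proof.
move=> v; rewrite /balanced_at /D; have [->|vc] := eqVneq v c.
  rewrite /star_diag /leg_weight eqxx -/(leg_weight _) -PoszM divnK.
    by rewrite (big_morph Posz PoszD (erefl _)).
  exact: leg_weight_nbr_sum.
rewrite leg_sum // => [|w vw]; last by rewrite (off_weight vw).
rewrite star_diag_leg // PoszD mulrDl natz; congr (_ + _).
rewrite -PoszM -mulnA [(div_weight v * _)%N]mulnC weightM //.
by case: (adj c v) => //; rewrite /leg_weight eqxx.
Qed.

(* On a leg, away from its vertex [u] nearest to [c], the diagonal entries are
   the degrees: hence [x] is constant on the leg. *)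
Lemma balanced_leg_const (R : pzRingType) (x : S -> R) (u v : S) :
    adj c u -> leg v = leg u ->
    (forall w, w != c -> leg w = leg u -> balanced_at (intr_fun R D) x w) ->
  v != c -> x v = x u.
Proof.
move=> cu vu bal_x vc; pose e y z := off_adj y z && (leg y == leg u).
have e_sym : symmetric e.
  move=> y z; rewrite /e off_adj_sym; case yz: (off_adj z y) => //=.
  by rewrite (off_adj_leg yz).
have e_irr : irreflexive e by move=> y; rewrite /e off_adj_irrefl.
have ac_e : acyclic e.
  by apply: acyclic_sub (tree_acyclic tS) => y z /andP[/andP[]].
have e_const : forall y z, e y z -> x y = x z.
  apply: (harmonic_forest_const (a := u) e_sym e_irr ac_e) => y yu.
  have [/andP[yc /eqP ly]|] := boolP ((y != c) && (leg y == leg u)); last first.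
    move=> y_out; rewrite big_pred0 // => z; apply: contraNF y_out.
    by case/andP=> /and3P[_ -> _] ->.
  have cy : adj c y = false.
    by apply: contraNF yu => cy; rewrite -leg_eq_nbr // ly.
  rewrite (eq_bigl (fun z => adj y z)) => [|z]; last first.
    rewrite /e /off_adj ly eqxx yc andbT /=; apply: andb_idr.
    by apply: contraTneq => ->; rewrite adj_sym cy.
  have := bal_x y yc ly; rewrite /balanced_at /intr_fun /D star_diag_leg // cy.
  by rewrite subn0 addn0 sumrB sum_nbr_const => <-; rewrite subrr.
apply: (connect_const (e := off_adj)) => [y z uy yz|]; last exact/leg_eqP.
by apply: e_const; rewrite /e yz; apply/eqP/esym/leg_eqP.
Qed.

(** As [x] is constant on the leg, the terms of the leg cancel in the row of [u] and only the term
    of [c] is left. *)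
Lemma balanced_leg_root (R : pzRingType) (x : S -> R) (u : S) :
    adj c u -> (forall w, w != c -> leg w = leg u -> balanced_at (intr_fun R D) x w) ->
  (div_weight u)%:R * x u = x c.
Proof.
move=> cu bal_x; have uc := nbr_neq cu; have := bal_x u uc erefl.
rewrite /balanced_at /intr_fun /D star_diag_leg // leg_sum // => [|w uw].
  by rewrite cu mul1n -pmulrn natrD mulrDl => /addrI.
apply: balanced_leg_const => //; first by rewrite (off_adj_leg uw).
by case/and3P: uw.
Qed.

(** The zero at [b] forces [x c = 0]; on the legs outside [A] the ratio is 1, so [x] vanishes there;
    the row of [c] then gives [x a = 0], and [x] is constant on each leg. *)
Lemma star_diag_kernel0 (p : nat) (x : S -> 'F_p) :
    prime p -> balanced (intr_fun _ D) x -> {in A :\ a, forall z, x z = 0} ->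
  forall v, x v = 0.
Proof.
move=> p_pr bal_x x0; have bA : b \in A :\ a by rewrite in_setD1 eq_sym ab.
have xc : x c = 0.
  by rewrite -(balanced_leg_root (mem_A_adj Ab)) ?x0 ?mulr0 // => w _ _; apply: bal_x.
have ca := mem_A_adj Aa; have cb := mem_A_adj Ab.
have xN u : adj c u -> u != a -> x u = 0.
  move=> cu ua; have [Au|Au] := boolP (u \in A); first by rewrite x0 // in_setD1 ua.
  have := balanced_leg_root cu (fun w _ _ => bal_x w); rewrite xc /div_weight.
  rewrite on_leg_nbr // (negPf Au) /on_end !leg_eq_nbr // (negPf ua).
  by case: eqVneq Au => [->|_]; rewrite ?Ab //= mul1r.
have xa : x a = 0.
  have := bal_x c; rewrite /balanced_at xc mulr0 (bigD1 a) //= big1 ?addr0 //.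
  by move=> u /andP[cu ua]; apply: xN.
move=> v; have [-> //|vc] := eqVneq v c; have [u cu uv] := leg_cover vc.
rewrite (balanced_leg_const cu) //.
by have [->|/(xN u cu)] := eqVneq u a.
Qed.

Lemma star_diag_delta (z0 : S) : z0 \in A :\ a ->
  exists2 x : S -> 'F_2, balanced (intr_fun _ D) x
                       & {in A :\ a, forall z, x z = (z == z0)%:R}.
Proof.
rewrite in_setD1 => /andP[z0a Az0].
(* The indicator of the legs of [z0] and [a]. Modulo 2 the two ones cancel in the row of [c], and
   the even ratios on these legs are compatible with the value 0 at [c]. *)
pose h (v : S) : 'F_2 := (leg v == leg z0)%:R + (leg v == leg a)%:R.
pose x v := if v == c then 0 else h v.
have hN u : adj c u -> h u = (u == z0)%:R + (u == a)%:R.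
  by move=> cu; rewrite /h !leg_eq_nbr //; apply: mem_A_adj.
exists x => [v|z]; last first.
  rewrite in_setD1 => /andP[za Az]; have cz := mem_A_adj Az.
  by rewrite /x (negPf (nbr_neq cz)) hN // (negPf za) addr0.
rewrite /balanced_at; have [->|vc] := eqVneq v c.
  rewrite {1}/x eqxx mulr0 (eq_bigr (fun u => (u == z0)%:R + (u == a)%:R)); last first.
    by move=> u cu; rewrite /x (negPf (nbr_neq cu)) hN.
  have sum1 w : adj c w -> \sum_(u | adj c u) (u == w)%:R = 1 :> 'F_2.
    move=> cw; rewrite (bigD1 w) //= eqxx big1 ?addr0 // => u /andP[_ uw].
    by rewrite (negPf uw).
  rewrite big_split /= !sum1 ?mem_A_adj //; exact/val_inj.
rewrite leg_sum // => [|w vw]; last first.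
  by have /and3P[_ _ wc] := vw; rewrite /x (negPf wc) (negPf vc) /h (off_adj_leg vw).
rewrite /intr_fun /D star_diag_leg // {3}/x eqxx if_same addr0.
rewrite -pmulrn natrD mulrDl -[RHS]addr0; congr (_ + _).
have [/div_weight_even n_even|nv] := boolP (on_leg v).
  rewrite natrM.
  have -> : (div_weight v)%:R = 0 :> 'F_2.
    by apply/eqP; rewrite -(dvdn_pcharf (pchar_Fp (isT : prime 2))) dvdn2 n_even.
  by rewrite mulr0 mul0r.
suff -> : x v = 0 by rewrite mulr0.
rewrite /x (negPf vc) /h; move: nv; rewrite /on_leg.
have [->|_] := eqVneq (leg v) (leg z0); first by rewrite imset_f.
by have [->|_] := eqVneq (leg v) (leg a); [rewrite imset_f|rewrite addr0].
Qed.

Lemma sharp_star : sharp D (A :\ a).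
Proof.
split=> //.
- exists (fun v => (leg_weight v)%:Z); last exact: balanced_leg_weight.
  by move=> v; rewrite /leg_weight; do !case: ifP.
- by move=> p p_pr x bal_x x0; apply: star_diag_kernel0.
- exact: star_diag_delta.
Qed.

(* For odd [p] the positive weights of the structure are units, and weighting
   the rows with them gives a vanishing combination. *)
Lemma star_diag_row_leaf (p : nat) (x : S -> 'F_p) : b \in leaves S -> prime p ->
    (forall u, u != b -> balanced_at (intr_fun _ D) x u) ->
  balanced_at (intr_fun _ D) x b.
Proof.
move=> lb p_pr bal_x; have cb := mem_A_adj Ab; have ca := mem_A_adj Aa.
have bc := nbr_neq cb.
have [p2|p_odd] := eqVneq p 2.
  have even0 n : ~~ odd n -> n%:R = 0 :> 'F_p.
    move=> n_even; apply/eqP; rewrite -(dvdn_pcharf (pchar_Fp p_pr)).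
    by rewrite p2 dvdn2.
  (* The rows on the leg of [a] are all available and its ratio is even, so [x c = 0]. The entry of
     the leaf [b] is even too, and both sides of its row vanish. *)
  have xc : x c = 0.
    rewrite -(balanced_leg_root ca) => [|w _ wa].
      by rewrite even0 ?mul0r // div_weight_even // on_leg_nbr.
    by apply: bal_x; apply: contra_neq ab => wb; apply: leg_inj; rewrite ?inE // -wa wb.
  rewrite /balanced_at (leaf_sum _ lb cb) xc /intr_fun /D star_diag_leg // cb.
  have -> : deg b = 1%N by apply/eqP; move: lb; rewrite inE.
  by rewrite mul1n -pmulrn even0 ?mul0r // div_weight_even // on_leg_nbr.
pose m v : 'F_p := (leg_weight v)%:R.
have mb : m b != 0.
  rewrite /m -(dvdn_pcharf (pchar_Fp p_pr)) /leg_weight (negPf bc) /on_end eqxx orbT.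
  by case: ifP => _; rewrite ?dvdn1 ?gtn_eqF ?prime_gt1 // dvdn_prime2.
have bal_m v : intr_fun 'F_p D v * m v = \sum_(w | adj v w) m w.
  have := congr1 (fun k : int => k%:~R : 'F_p) (balanced_leg_weight v).
  by rewrite intrM rmorph_sum.
(* The matrix is symmetric and [m] is in its kernel, so the rows weighted by [m] sum to zero; all
   the terms but that of [b] are known to vanish. *)
have : \sum_v m v * (intr_fun _ D v * x v - \sum_(w | adj v w) x w) = 0.
  under eq_bigr do rewrite mulrBr mulrCA mulrA bal_m mulr_suml mulr_sumr.
  rewrite sumrB; apply/eqP; rewrite subr_eq0; apply/eqP.
  rewrite [RHS](exchange_big_dep predT) //=; apply: eq_bigr => v _.
  by apply: eq_bigl => w; rewrite adj_sym.
rewrite (bigD1 b) //= [X in _ + X = _]big1 ?addr0 => [/eqP|v vb]; last first.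
  apply/eqP; rewrite mulf_eq0 subr_eq0; apply/orP; right; exact/eqP/bal_x.
by rewrite mulf_eq0 (negPf mb) subr_eq0 => /eqP.
Qed.

End Weights.
End Centre.

(** * Leaves of starlike trees and of paths *)

Lemma deg2_nbr (G : sgraph) (x y z w : G) :
  (deg x <= 2)%N -> adj x y -> adj x z -> y != z -> adj x w -> (w == y) || (w == z).
Proof.
move=> deg_x xy xz yz xw; apply: contraT; rewrite negb_or => /andP[wy wz].
suff: (3 <= deg x)%N by rewrite ltnNge deg_x.
have <- : #|w |: [set y; z]| = 3%N by rewrite cardsU1 cards2 !inE yz negb_or wy wz.
apply/subset_leq_card/subsetP=> u; rewrite !inE.
by case/or3P=> /eqP->.
Qed.

Lemma sorted_rcons2 (T : Type) (e : rel T) (s : seq T) (y z : T) :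
  sorted e (rcons (rcons s y) z) -> e y z.
Proof.
by case: s => [|x s]; rewrite /= ?andbT // rcons_path last_rcons => /andP[].
Qed.

(** An inner vertex of the path already has its two neighbours on it, and an end that is a leaf its
    only one. *)
Lemma leaf_path_closed (G : sgraph) (s : seq G) (x y : G) :
    (2 <= size s)%N -> sorted (@adj G) s -> uniq s ->
    {in s, forall u, deg u <= 2}%N ->
    head x s \in leaves G -> last x s \in leaves G ->
  x \in s -> adj x y -> y \in s.
Proof.
move=> s2 es Us deg_s lh ll xs xy; have degx := deg_s x xs.
case/path.splitPr: xs s2 es Us lh ll {deg_s} => p1 p2; rewrite size_cat sorted_cat_cons.
move=> s2 /andP[ep1 ep2] Us lh ll; rewrite mem_cat inE.
case: p2 s2 ep2 Us lh ll => [|z p2] s2 ep2 Us lh ll.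
  case/lastP: p1 s2 ep1 Us lh ll => [|p1 u] //= _ ep1 _ _.
  have := sorted_rcons2 ep1; rewrite adj_sym last_cat /= => ux /leafP[w _ w_uniq].
  by rewrite (w_uniq y) // (w_uniq u ux) mem_rcons mem_head.
case/andP: ep2 => xz _; case/lastP: p1 s2 ep1 Us lh ll => [|p1 u] _ ep1 Us lh _.
  by case/leafP: lh => w _ w_uniq; rewrite inE (w_uniq y) // (w_uniq z) // eqxx !orbT.
have := sorted_rcons2 ep1; rewrite adj_sym => xu.
have uz : u != z.
  move: Us; rewrite cat_uniq => /and3P[_ /hasPn/(_ z) + _].
  by rewrite !inE eqxx orbT mem_rcons inE => /(_ isT); rewrite negb_or eq_sym => /andP[].
by case/orP: (deg2_nbr degx xu xz uz xy) => /eqP->;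
  rewrite ?mem_rcons !inE eqxx ?orbT.
Qed.

(** Two leaves on one leg would be joined by a path off [c], with all degrees at most 2. Such a path
    is closed under adjacency, against connectedness. So the leaves inject into the legs, each of
    which contains a neighbour of [c]. *)
Lemma starlike_leaves_le_deg (S : sgraph) (c : S) :
  is_tree S -> branch_vertices S = [set c] -> (#|leaves S| <= deg c)%N.
Proof.
move=> tS bE; have [_ conn_S _] := tS.
have deg_c : (3 <= deg c)%N by have := set11 c; rewrite -bE inE.
have leaf_c v : v \in leaves S -> v != c.
  by apply: contraTneq => ->; rewrite inE gtn_eqF // ltnW.
have leg_leaf : {in leaves S &, injective (leg c)}.
  move=> u v lu lv /leg_eqP/connectP[p0 ep0 vE]; move: lv; rewrite {v}vE.
  case/shortenP: ep0 => p ep Up _ lv.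
  have [->//|p_neq0] := eqVneq p [::].
  have p_c w : w \in u :: p -> w != c.
    rewrite inE => /predU1P[->|]; first exact: leaf_c.
    elim: (p) (u) ep => //= y q IHq z /andP[/and3P[_ _ yc] eq].
    by rewrite inE => /predU1P[->//|]; apply: IHq eq.
  have sub_off : subrel (off_adj c) (@adj S) by move=> ? ? /andP[].
  have cl : closed (@adj S) (mem (u :: p)).
    apply: intro_closed; first exact/sym_connect_sym/adj_sym.
    move=> x y xy xp; apply: (leaf_path_closed _ _ Up _ lu lv xp xy).
    - by case: (p) p_neq0.
    - exact: sub_path ep.
    - move=> w /p_c; apply: contraNT; rewrite -ltnNge => bw.
      by rewrite -in_set1 -bE inE.
  have := closed_connect cl (conn_S u c); rewrite mem_head => /esym/p_c.
  by rewrite eqxx.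
rewrite -(card_in_imset leg_leaf).
apply: leq_trans (leq_imset_card (leg c) (nbhd c)).
apply/subset_leq_card/subsetP=> _ /imsetP[v lv ->].
have [u cu <-] := leg_cover tS (leaf_c v lv).
by rewrite imset_f // inE.
Qed.

Lemma path_graph_leaves (n : nat) : (0 < n)%N -> (#|leaves (path_graph n)| <= 2)%N.
Proof.
case: n => // n _; apply: leq_trans (_ : #|[set ord0; ord_max : 'I_n.+1]| <= 2)%N.
  apply/subset_leq_card/subsetP=> i li; rewrite !inE; apply: contraT.
  rewrite negb_or => /andP[i0 im]; case/leafP: li => w _ w_uniq.
  have i_gt0 : (0 < i)%N by rewrite lt0n.
  have i_ltn : (i < n)%N.
    have := ltn_ord i; rewrite ltnS leq_eqVlt => /orP[|//].
    by rewrite -[_ == _]/(i == ord_max) (negPf im).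
  (* A leaf strictly inside would have [i.-1] and [i.+1] both equal to its only neighbour [w]. *)
  have Ew (j : nat) : (j < n.+1)%N -> (j == i.+1) || (i == j.+1 :> nat) -> j = w :> nat.
    by move=> jn ji; rewrite -(w_uniq (Ordinal jn)).
  have E1 : i.-1 = w :> nat.
    by apply: Ew; rewrite ?prednK // ?eqxx ?orbT // ltnW.
  have E2 : i.+1 = w :> nat by apply: Ew; rewrite ?eqxx.
  by move: E2; rewrite -E1; lia.
by rewrite cards2; case: eqP.
Qed.

Lemma iso_card_leaves (G H : sgraph) : graph_iso G H -> #|leaves G| = #|leaves H|.
Proof.
case=> f bij_f mono_f; rewrite -(iso_card_preim bij_f); apply: eq_card => v.
by rewrite !inE (iso_deg bij_f mono_f).
Qed.

Lemma subset_of_card (T : finType) (B : {set T}) (b : T) (k : nat) :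
    b \in B -> (0 < k <= #|B|)%N ->
  exists A : {set T}, [/\ A \subset B, b \in A & #|A| = k].
Proof.
move=> Bb /andP[k_gt0 kB]; have: (k.-1 <= #|B :\ b|)%N.
  by rewrite (cardsD1 b) Bb in kB; case: k k_gt0 kB.
case/card_geqP=> s [Us sz_s sB]; exists (b |: [set x in s]).
have bs : b \notin s by apply/negP=> /sB; rewrite in_setD1 eqxx.
split; rewrite ?setU11 //.
  by rewrite subUset sub1set Bb; apply/subsetP=> x; rewrite inE => /sB/setD1P[].
by rewrite cardsU1 inE bs cardsE (card_uniqP Us) sz_s add1n prednK.
Qed.

Lemma deg_sum (G : sgraph) (v : G) : deg v = \sum_(w | adj v w) 1%N :> nat.
Proof. by rewrite sum1_card; apply: eq_card => w; rewrite /nbhd inE. Qed.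

(** Gluing a single vertex reproduces [S]. This excludes a one-vertex [T'] from a splitting, where
    the glued tree has at least two branch vertices. *)
Lemma glue_branch_le1 (S T' : sgraph) (vs : S) (vt : T') :
    vs \in leaves S -> (#|T'| <= 1)%N ->
  (#|branch_vertices (glue vs vt)| <= #|branch_vertices S|)%N.
Proof.
move=> lvs T'1; apply: leq_trans (leq_imset_card (glue_inl vs vt) _).
apply/subset_leq_card/subsetP=> -[u|y]; rewrite inE => deg3; apply/imsetP.
  exists (val u); last by rewrite glue_inlT.
  move: deg3; rewrite inE !deg_sum.
  by rewrite (glue_sum_inl (V := nat) (fun=> 1%N)).
case/leafP: (lvs) => c vsc _; move: deg3.
rewrite deg_sum (glue_sum_inr (V := nat) (fun=> 1%N)) big_pred0.
  rewrite add0r (leaf_sum (V := nat) (c := c) _ lvs); last by rewrite adj_sym.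
  by case: eqP.
move=> w; apply: contraTF T'1 => yw; rewrite -ltnNge; apply/card_gt1P.
by exists y, w; split=> //; apply: contraTneq yw => ->; rewrite adj_irrefl.
Qed.

(** Take for [A] any [t + 2] neighbours of [c] including [b], and for [a] one of them other than
    [b]. The last clause is the condition that [sharp_glue] puts on [vs], for gluing at [b]. *)
Lemma starlike_sharp (S : sgraph) (c b : S) (t : nat) :
    is_tree S -> branch_vertices S = [set c] -> adj c b -> (t.+2 <= deg c)%N ->
  exists d Z, [/\ sharp (G := S) d Z, b \in Z, #|Z| = t.+1 &
    b \in leaves S -> forall p, prime p -> forall X : S -> 'F_p,
       (forall u, u != b -> balanced_at (intr_fun _ d) X u) ->
       balanced_at (intr_fun _ d) X b].
Proof.
move=> tS bE cb deg_c; have bN : b \in nbhd c by rewrite inE.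
have [A [sAN Ab cardA]] := subset_of_card (k := t.+2) bN deg_c.
have: (0 < #|A :\ b|)%N by move: cardA; rewrite (cardsD1 b) Ab add1n => -[->].
case/card_gt0P=> a; rewrite in_setD1 => /andP[ab Aa].
exists (fun v => (star_diag c A a b v)%:Z), (A :\ a); split.
- exact: sharp_star.
- by rewrite in_setD1 eq_sym ab.
- by move: cardA; rewrite (cardsD1 a) Aa add1n => -[].
- by move=> lb p p_pr X; apply: star_diag_row_leaf.
Qed.

(** * Starlike decompositions *)

Lemma starlike_centre (S : sgraph) :
  is_starlike S -> exists2 c, branch_vertices S = [set c] & (3 <= deg c)%N.
Proof.
case=> _ /eqP/cards1P[c bE]; exists c => //.
by have := set11 c; rewrite -bE inE.
Qed.

Lemma starlike_or_path_sharp (T : sgraph) (t : nat) :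
    is_tree T -> (2 <= #|T|)%N -> is_starlike T \/ is_path_graph T ->
    (t <= #|leaves T| - 2)%N ->
  exists (d : T -> int) Z, sharp d Z /\ #|Z| = t.+1.
Proof.
move=> tT T2 [starT|[n n_gt0 isoT]] t_le.
  have [c bE deg_c] := starlike_centre starT.
  have [b cb] := tree_has_nbr c tT T2.
  have t2 : (t.+2 <= deg c)%N by have := starlike_leaves_le_deg tT bE; lia.
  by have [d [Z [dZ _ cardZ _]]] := starlike_sharp tT bE cb t2; exists d, Z.
(* A path has at most two leaves, so only [t = 0] is left. *)
have := path_graph_leaves n_gt0; rewrite -(iso_card_leaves isoT) => leaves2.
have -> : t = 0%N by lia.
have /card_gt0P[a _] := ltnW T2.
by exists (fun v => (deg v)%:Z), [set a]; split; [exact: sharp_laplacian|rewrite cards1].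
Qed.

Lemma leaves_ge2 (G : sgraph) : is_tree G -> (2 <= #|G|)%N -> (2 <= #|leaves G|)%N.
Proof.
move=> tG G2; have [u [v [uv lu lv]]] := tree_two_leaves tG G2.
by apply/card_gt1P; exists u, v.
Qed.

(** One induction carries the bound and all the realizations. The sum is a natural number because
    every summand is nonnegative. The sets have one element more than the number of invariant
    factors, since [r] itself takes one dimension of the kernel. *)
Lemma decomposition_forcing_sharp (T : sgraph) (Ss : seq sgraph) :
    starlike_decomposition T Ss -> is_tree T -> (2 <= #|T|)%N ->
  exists m : nat,
    [/\ \sum_(S <- Ss) (#|leaves S|%:Z - 2) = m%:Z,
        exists2 Z : {set T}, forcing Z & (#|Z| <= m.+1)%N
      & forall t, (t <= m)%N ->
          exists (d : T -> int) Z, sharp d Z /\ #|Z| = t.+1].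
Proof.
elim=> {T Ss} [T _ spT|T S T' vs vt Ss _ splitT _ IH] tT T2.
  have l2 := leaves_ge2 tT T2; exists (#|leaves T| - 2)%N; split.
  - by rewrite big_seq1; lia.
  - have /card_gt0P[w lw] := ltnW l2.
    exists (leaves T :\ w); first exact: forcing_leaves.
    by move: l2; rewrite (cardsD1 w) lw; lia.
  - by move=> t; apply: starlike_or_path_sharp.
have [[_ branch2] starS tT' [lvs [c bc cvs]] isoT] := splitT.
have [tS bS1] := starS; have [c' bE _] := starlike_centre starS.
have cc' : c' = c by apply/eqP; move: bc; rewrite bE inE eq_sym.
rewrite {c'}cc' in bE.
have [f bij_f mono_f] := isoT.
have T'2 : (2 <= #|T'|)%N.
  rewrite ltnNge; apply/negP=> T'1; have := glue_branch_le1 vt lvs T'1.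
  by rewrite (iso_card_branch bij_f mono_f) bS1 leqNgt branch2.
have S2 : (2 <= #|S|)%N.
  by apply/card_gt1P; exists c, vs; split=> //; apply: contraTneq cvs => ->; rewrite adj_irrefl.
have l2 := leaves_ge2 tS S2.
have [m' [sum_m' [Z' forceZ' cardZ'] sharp']] := IH tT' T'2.
exists (#|leaves S| - 2 + m')%N; split.
- by rewrite big_cons sum_m'; lia.
- have [w /setD1P[wvs lw]] : exists w, w \in leaves S :\ vs.
    by apply/card_gt0P; move: l2; rewrite (cardsD1 vs) lvs.
  have forceZ := forcing_glue (vt := vt) tS lvs bc cvs lw wvs forceZ'.
  eexists; first exact: (iso_forcing bij_f mono_f forceZ).
  rewrite iso_card_preim //; apply: leq_trans (card_forcing_glue _ _ lvs lw wvs) _.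
  by rewrite -addnS leq_add2l.
(* Let [T'] account for as many of the [t] factors as it can, and [S] for the rest. *)
move=> t t_le; pose t' := minn t m'; have [|d' [Z1 [sharpZ' cardZ'']]] := sharp' t'.
  exact: geq_minr.
have t_sub : ((t - t').+2 <= deg c)%N.
  by have := starlike_leaves_le_deg tS bE; rewrite /t'; lia.
have [D [ZS [sharpS ZSvs cardZS extD]]] := starlike_sharp tS bE cvs t_sub.
have sharpG := sharp_glue vt ZSvs (extD lvs) sharpS sharpZ'.
eexists; eexists; split; first exact: (iso_sharp bij_f mono_f sharpG).
rewrite iso_card_preim // card_sharp_glue // cardZS cardZ'' /t' /=; lia.
Qed.

(** * Torsion of the cokernel *)

Section PTorsion.
Variables (V : finZmodType) (p : nat).
Hypothesis p_pr : prime p.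

Definition ptorsion : {set V} := [set x | x *+ p == 0].

Lemma ptorsion_group_set : group_set ptorsion.
Proof.
apply/group_setP; split=> [|x y]; first by rewrite inE mul0rn.
by rewrite !inE mulrnDl => /eqP-> /eqP->; rewrite addr0.
Qed.

(** The [p]-torsion is an elementary abelian subgroup, so its dimension is at most the rank, which
    is the number of invariant factors. *)
Lemma num_invariant_factors_ge k :
  (p ^ k <= #|ptorsion|)%N -> (k <= num_invariant_factors V)%N.
Proof.
pose E := Group ptorsion_group_set => le_k.
rewrite /num_invariant_factors size_abelian_type ?FinRing.zmod_abelian //.
have abE : p.-abelem%g E.
  apply/abelemP => //; split=> [|x]; first exact: FinRing.zmod_abelian.
  by rewrite inE FinRing.zmodXgE => /eqP.
apply: leq_trans (p_rank_le_rank p _).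
apply: (@leq_trans (logn p #|E|)); last first.
  by apply/p_rank_geP; exists E; apply/pnElemP; split=> //; apply: subsetT.
rewrite -(leq_exp2l _ _ (prime_gt1 p_pr)) -(card_pgroup (abelem_pgroup abE)).
exact: le_k.
Qed.

End PTorsion.

(** The rank is the [p]-rank for some prime [p], attained by an elementary abelian subgroup, which
    lies in the [p]-torsion. *)
Lemma num_invariant_factors_le (V : finZmodType) k :
  (forall p, prime p -> #|ptorsion V p| <= p ^ k)%N -> (num_invariant_factors V <= k)%N.
Proof.
move=> le_k; rewrite /num_invariant_factors size_abelian_type ?FinRing.zmod_abelian //.
have [p p_pr ->] := rank_witness [set: V]%G.
have /p_rank_geP[E EE] := leqnn 'r_p([set: V]%G)%g.
have cardE := card_pnElem EE; have /pnElemP[_ abE _] := EE.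
rewrite -(leq_exp2l _ _ (prime_gt1 p_pr)) -cardE.
apply: leq_trans (le_k p p_pr); apply/subset_leq_card/subsetP=> x Ex.
by have /(abelemP p_pr)[_ /(_ x Ex)] := abE; rewrite inE FinRing.zmodXgE => /eqP.
Qed.

(** * The kernel modulo a prime and the torsion of the cokernel *)

Section ModP.
Variables (n p : nat) (M : 'M[int]_n) (r : 'cV[int]_n).
Hypotheses (p_pr : prime p) (Mr : M *m r = 0).
Notation redp := (map_mx (intr : int -> 'F_p)).
Hypothesis r_neq0 : redp r != 0.
Hypothesis ker_r :
  forall x : 'cV[int]_n, M *m x = 0 -> exists a : 'F_p, redp x = a *: redp r.

Definition kerp : {set 'cV['F_p]_n} := [set y | redp M *m y == 0].

Definition liftp (y : 'cV['F_p]_n) : 'cV[int]_n := map_mx (fun a : 'F_p => (a : nat)%:Z) y.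

Lemma liftpK y : redp (liftp y) = y.
Proof. by apply/matrixP=> i j; rewrite !mxE -pmulrn natr_Zp. Qed.

Lemma redp_eq0 (x : 'cV[int]_n) : redp x = 0 -> exists w, x = w *+ p.
Proof.
move=> x0; exists (map_mx (fun a => (a %/ p)%Z) x); apply/matrixP=> i j.
rewrite mulmxnE mxE -mulr_natr natz divzK //.
have /matrixP/(_ i j) := x0; rewrite !mxE => /eqP.
by rewrite (dvdz_pcharf (pchar_Fp p_pr)).
Qed.

Lemma redpMn (x : 'cV[int]_n) : redp (x *+ p) = 0.
Proof.
apply/matrixP=> i j; rewrite !mxE mulmxnE rmorphMn /= -mulr_natr.
by rewrite pchar_Fp_0 ?mulr0.
Qed.

Lemma mulrnI_col (x y : 'cV[int]_n) : x *+ p = y *+ p -> x = y.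
Proof.
move=> xy; apply/matrixP=> i j; have /matrixP/(_ i j) := xy.
rewrite !mulmxnE => /eqP; rewrite -subr_eq0 -mulrnBl mulrn_eq0.
by rewrite -[p == 0]negbK -lt0n prime_gt0 //= subr_eq0 => /eqP.
Qed.

Let piM (v : 'cV[int]_n) : coker_mx M := (\pi_(Quotient.quot (im_mx M)) v)%qT.

Lemma piM_eq v w : (piM v == piM w) = (v - w \in im_mx M).
Proof. exact: coker_eq. Qed.

Lemma piM_mulrn v : piM (v *+ p) = piM v *+ p.
Proof. by rewrite /piM [LHS]raddfMn. Qed.

Lemma piM_eq0 v : (piM v == 0) = (v \in im_mx M).
Proof. by rewrite -[0](raddf0 (\pi_(Quotient.quot (im_mx M)))%qT) [LHS]piM_eq subr0. Qed.

Definition divp (y : 'cV['F_p]_n) : 'cV[int]_n :=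
  map_mx (fun a => (a %/ p)%Z) (M *m liftp y).

(** On [kerp] the division by [p] is exact and the class is torsion; the default 0 can only occur
    elsewhere. *)
Definition kerp_class (y : 'cV['F_p]_n) : critical_group M := insubd 0 (piM (divp y)).

Lemma divpE y : y \in kerp -> divp y *+ p = M *m liftp y.
Proof.
rewrite inE => /eqP My; have [w wE] : exists w, M *m liftp y = w *+ p.
  by apply: redp_eq0; rewrite map_mxM liftpK.
rewrite /divp wE; congr (_ *+ p); apply/matrixP=> i j; rewrite mxE mulmxnE.
by rewrite -mulr_natr natz mulzK // -lt0n prime_gt0.
Qed.

Lemma kerp_class_val y : y \in kerp -> val (kerp_class y) = piM (divp y).
Proof.
move=> Ky; rewrite insubdK //; apply/torsionP; exists p; first exact: prime_gt0.
by apply/eqP; rewrite -piM_mulrn piM_eq0 divpE //; apply/im_mxP; exists (liftp y).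
Qed.

Lemma val_mulrn (u : critical_group M) k : val (u *+ k) = val u *+ k.
Proof. exact: (raddfMn val). Qed.

Lemma kerp_class_ptorsion y : y \in kerp -> kerp_class y \in ptorsion (critical_group M) p.
Proof.
move=> Ky; rewrite inE; apply/eqP/val_inj; rewrite val_mulrn kerp_class_val //.
apply/eqP; rewrite -piM_mulrn piM_eq0.
by rewrite divpE //; apply/im_mxP; exists (liftp y).
Qed.

(** If the representatives differ by [M *m w], then [liftp y - liftp y' - w *+ p] is an integral
    kernel vector, hence a multiple of [r] modulo [p]. Conversely [liftp y - liftp y'] minus a
    multiple of [r] is some [w *+ p], and the representatives differ by [M *m w]. *)
Lemma kerp_class_eq y y' : y \in kerp -> y' \in kerp ->
  reflect (exists a : 'F_p, y = y' + a *: redp r) (kerp_class y == kerp_class y').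
Proof.
move=> Ky Ky'; rewrite -val_eqE !kerp_class_val // piM_eq.
apply: (iffP (im_mxP _ _)) => [[w wE]|[a yE]].
  have [|a aE] := ker_r (x := liftp y - liftp y' - w *+ p).
    rewrite !mulmxBr -!divpE // [M *m (w *+ p)]raddfMn /= -wE.
    by rewrite mulrnBl subrr.
  by exists a; rewrite -aE !map_mxB redpMn !liftpK subr0 addrC subrK.
have [w wE] : exists w, liftp y - liftp y' - (a : nat)%:Z *: r = w *+ p.
  apply: redp_eq0; rewrite !map_mxB map_mxZ !liftpK yE /= -pmulrn natr_Zp.
  by rewrite addrAC addrK subrr.
exists w; apply: mulrnI_col; rewrite mulrnBl !divpE // -mulmxBr.
have -> : liftp y - liftp y' = (a : nat)%:Z *: r + w *+ p by rewrite -wE [RHS]addrC subrK.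
by rewrite mulmxDr -scalemxAr Mr scaler0 add0r raddfMn.
Qed.

(** If [v] represents [u], then [v *+ p = M *m z], and [z] modulo [p] is the preimage: lifting it
    again changes [z] by a multiple of [p], thus [v] by an element of the image. *)
Lemma kerp_class_surj u :
  u \in ptorsion (critical_group M) p -> exists2 y, y \in kerp & kerp_class y = u.
Proof.
rewrite inE => /eqP up0; pose v : 'cV[int]_n := generic_quotient.repr (val u : Quotient.quot (im_mx M)).
have uv : val u = piM v by rewrite /piM /v reprK.
have /im_mxP[z zE] : v *+ p \in im_mx M.
  by rewrite -piM_eq0 piM_mulrn -uv -val_mulrn up0.
have Kz : redp z \in kerp by rewrite inE -map_mxM -zE redpMn.
exists (redp z) => //; apply: val_inj; rewrite kerp_class_val // uv.
apply/eqP; rewrite piM_eq; have [w wE] : exists w, liftp (redp z) - z = w *+ p.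
  by apply: redp_eq0; rewrite map_mxB liftpK subrr.
apply/im_mxP; exists w; apply: mulrnI_col.
by rewrite mulrnBl divpE // zE -mulmxBr wE raddfMn.
Qed.

Lemma kerp_redp_r a : a *: redp r \in kerp.
Proof. by rewrite inE -scalemxAr -map_mxM Mr map_mx0 scaler0. Qed.

Lemma card_kerp : #|kerp| = (p * #|ptorsion (critical_group M) p|)%N.
Proof.
rewrite -sum1_card (partition_big kerp_class (mem (ptorsion (critical_group M) p))) /=;
  last by move=> y; apply: kerp_class_ptorsion.
rewrite mulnC -sum_nat_const; apply: eq_bigr => u /kerp_class_surj[y Ky <-].
rewrite sum1_card -[RHS](card_Fp p_pr).
pose f (a : 'F_p) := y + a *: redp r.
have f_inj : injective f.
  move=> a b /addrI/eqP; rewrite -subr_eq0 -scalerBl scaler_eq0 (negPf r_neq0) orbF.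
  by rewrite subr_eq0 => /eqP.
rewrite -(card_imset _ f_inj); apply: eq_card => y'.
rewrite [LHS]inE; apply/andP/imsetP => [[Ky' /kerp_class_eq]|[a _ ->{y'}]].
  by case/(_ Ky' Ky)=> a ->; exists a.
have Kf : f a \in kerp.
  by move: Ky (kerp_redp_r a); rewrite !inE mulmxDr => /eqP-> /eqP->; rewrite addr0.
by split=> //; apply/kerp_class_eq => //; exists a.
Qed.
End ModP.

(** * Critical groups *)

Section Laplacian.
Variables (G : sgraph) (d : G -> int).

Definition of_col (R : Type) (y : 'cV[R]_#|G|) (v : G) : R := y (enum_rank v) 0.

Definition to_col (R : Type) (x : G -> R) : 'cV[R]_#|G| := \col_i x (enum_val i).

Lemma of_colK (R : Type) (y : 'cV[R]_#|G|) : to_col (of_col y) = y.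
Proof. by apply/colP=> i; rewrite mxE /of_col enum_valK. Qed.

Lemma to_colK (R : Type) (x : G -> R) v : of_col (to_col x) v = x v.
Proof. by rewrite /of_col mxE enum_rankK. Qed.

Lemma laplacian_mulE (R : pzRingType) (y : 'cV[R]_#|G|) (v : G) :
  (map_mx intr (laplacian d) *m y) (enum_rank v) 0 =
  (d v)%:~R * of_col y v - \sum_(w | adj v w) of_col y w.
Proof.
rewrite /laplacian map_mxB mulmxBl map_diag_mx mul_diag_mx !mxE enum_rankK.
congr (_ - _); rewrite (reindex enum_rank) /=; last exact: onW_bij (enum_rank_bij _).
rewrite [RHS]big_mkcond /=; apply: eq_bigr => w _.
by rewrite !mxE !enum_rankK /of_col; case: adj; rewrite ?mul1r ?mul0r.
Qed.

Lemma laplacian_kernelP (R : pzRingType) (y : 'cV[R]_#|G|) :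
  map_mx intr (laplacian d) *m y = 0 <-> balanced (intr_fun R d) (of_col y).
Proof.
split=> [Ly v|bal_y].
  by apply/eqP; rewrite -subr_eq0 -laplacian_mulE Ly mxE.
apply/colP=> i; rewrite -[i]enum_valK laplacian_mulE mxE.
by apply/eqP; rewrite subr_eq0; apply/eqP; apply: bal_y.
Qed.

Lemma laplacian_vec (r : G -> int) : laplacian d *m vec r = 0 <-> balanced d r.
Proof.
have -> : laplacian d = map_mx intr (laplacian d).
  by apply/matrixP=> i j; rewrite [RHS]mxE intz.
rewrite laplacian_kernelP; split=> bal_r v; have := bal_r v; rewrite /balanced_at;
  rewrite [of_col _ v]to_colK /intr_fun intz => ->.
  by apply: eq_bigr => w _; apply: to_colK.
by apply: eq_bigr => w _; rewrite to_colK.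
Qed.

End Laplacian.

(* Maximum principle: at a vertex maximizing [x / r] all the neighbours attain
   the maximum too. *)
Lemma balanced_proportional (G : sgraph) (d r x : G -> int) :
    is_tree G -> (forall v, 0 < r v) -> balanced d r -> balanced d x ->
  forall u v, x u * r v = x v * r u.
Proof.
move=> [/card_gt0P[v0 _] conn_G _] r_gt0 bal_r bal_x.
pose q v : rat := (x v)%:~R / (r v)%:~R.
have [u0 _ u0_max] := @arg_maxP _ _ G v0 predT q isT.
(* With denominators cleared, [y v] is [(q u0 - q v) * (r u0 * r v)]: a nonnegative kernel vector
   vanishing at [u0]. *)
pose y v := x u0 * r v - x v * r u0.
have y_ge0 v : 0 <= y v.
  have : q v <= q u0 := u0_max v isT; rewrite subr_ge0 /q.
  by rewrite ler_pdivrMr ?ltr0z // mulrAC ler_pdivlMr ?ltr0z // -!intrM ler_int.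
have bal_y v : d v * y v = \sum_(w | adj v w) y w.
  by rewrite sumrB -mulr_sumr -mulr_suml -bal_x -bal_r /y; ring.
have y0 v : y v = 0.
  case/connectP: (conn_G u0 v) => p ep ->{v}; elim/last_ind: p ep => [|p z IHp] /=.
    by rewrite /y subrr.
  rewrite rcons_path last_rcons => /andP[/IHp yl lz].
  (* Where [y] vanishes, its nonnegative values at the neighbours sum to zero. *)
  have := bal_y (last u0 p); rewrite yl mulr0 => /esym/eqP.
  by rewrite psumr_eq0 // => /allP/(_ z (mem_index_enum _))/implyP/(_ lz)/eqP.
move=> u v; apply: (mulIf (lt0r_neq0 (r_gt0 u0))).
have /eqP := y0 u; have /eqP := y0 v; rewrite !subr_eq0 => /eqP yv /eqP yu.
by rewrite mulrAC -yu [RHS]mulrAC -yv; ring.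
Qed.

(** Restriction to [Z] is injective on the kernel. *)
Lemma card_kerp_le (G : sgraph) (d : G -> int) (Z : {set G}) (p : nat) :
    prime p ->
    (forall x : G -> 'F_p, balanced (intr_fun _ d) x ->
       {in Z, forall z, x z = 0} -> forall v, x v = 0) ->
  (#|kerp p (laplacian d)| <= p ^ #|Z|)%N.
Proof.
move=> p_pr ub; pose f (y : 'cV['F_p]_#|G|) := \row_(i < #|Z|) of_col y (enum_val i).
have f_inj : {in kerp p (laplacian d) &, injective f}.
  move=> y y'; rewrite !inE => /eqP Ky /eqP Ky' fyy'.
  apply/eqP; rewrite -subr_eq0; apply/eqP; rewrite -[LHS]of_colK.
  apply/colP=> i; rewrite !mxE; apply: ub => [|z Zz].
    by apply/laplacian_kernelP; rewrite mulmxBr Ky Ky' subrr.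
  have /rowP/(_ (enum_rank_in Zz z)) := fyy'.
  by rewrite !mxE enum_rankK_in // /of_col !mxE => ->; rewrite subrr.
rewrite -(card_in_imset f_inj); apply: leq_trans (max_card _) _.
by rewrite card_mx card_Fp // mul1n.
Qed.

(** The given vectors are dual to the coordinates in [Z], so their combinations are distinct kernel
    vectors. *)
Lemma card_kerp_ge (G : sgraph) (d : G -> int) (Z : {set G}) (p : nat) :
    prime p ->
    (forall z0, z0 \in Z -> exists2 x : G -> 'F_p, balanced (intr_fun _ d) x
                                   & {in Z, forall z, x z = (z == z0)%:R}) ->
  (p ^ #|Z| <= #|kerp p (laplacian d)|)%N.
Proof.
move=> p_pr lb; have {lb} /fin_all_exists[x xP] (i : 'I_#|Z|) :
    exists x : G -> 'F_p, balanced (intr_fun _ d) x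
      /\ {in Z, forall z, x z = (z == enum_val i)%:R}.
  by have [x bal_x xE] := lb _ (enum_valP i); exists x.
pose f (a : 'rV['F_p]_#|Z|) := to_col (fun v => \sum_i a 0 i * x i v).
have f_inj : injective f.
  move=> a b fab; apply/rowP=> j.
  suff aE c : of_col (f c) (enum_val j) = c 0 j by rewrite -aE fab aE.
  rewrite to_colK (bigD1 j) //= big1 => [|i ij]; rewrite (proj2 (xP _)) ?enum_valP //.
    by rewrite eqxx mulr1 addr0.
  by rewrite (inj_eq enum_val_inj) eq_sym (negPf ij) mulr0.
have <- : #|[set: 'rV['F_p]_#|Z|]| = (p ^ #|Z|)%N.
  by rewrite cardsT card_mx card_Fp // mul1n.
rewrite -(card_imset _ f_inj); apply/subset_leq_card/subsetP=> _ /imsetP[a _ ->].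
rewrite inE; apply/eqP/laplacian_kernelP => v; rewrite /balanced_at to_colK.
under [RHS]eq_bigr do rewrite to_colK.
rewrite exchange_big mulr_sumr; apply: eq_bigr => i _.
by rewrite mulrCA (proj1 (xP i) v) mulr_sumr.
Qed.

(** Primitivity provides an entry [r w] prime to [p]; by proportionality an integral kernel vector
    [x] is [x w / r w] times [r] modulo [p], as [card_kerp] requires. *)
Lemma card_critical_ptorsion (G : sgraph) (d r : G -> int) (p : nat) :
    is_tree G -> arithmetical_structure d r -> prime p ->
  #|kerp p (laplacian d)| = (p * #|ptorsion (critical_group (laplacian d)) p|)%N.
Proof.
move=> tG [_ r_gt0 r_prim Lr] p_pr; have bal_r := (laplacian_vec d r).1 Lr.
have [w rw] : exists w, (r w)%:~R != 0 :> 'F_p.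
  apply/existsP; apply: contraT; rewrite negb_exists => /forallP r0.
  have: `|p%:Z|%N = 1%N.
    by apply: r_prim => v; rewrite (dvdz_pcharf (pchar_Fp p_pr)) -[_ == _]negbK r0.
  by move=> /= p1; rewrite p1 in p_pr.
apply: (card_kerp p_pr Lr) => [|x Lx].
  apply: contraNneq rw => /colP/(_ (enum_rank w)).
  by rewrite !mxE enum_rankK => ->.
exists ((of_col x w)%:~R / (r w)%:~R); apply/colP=> i; rewrite !mxE.
have bal_x : balanced d (of_col x).
  by apply/laplacian_vec; rewrite [vec _]of_colK.
have := balanced_proportional tG r_gt0 bal_r bal_x (enum_val i) w.
rewrite /of_col enum_valK => /(congr1 (intr : int -> 'F_p)); rewrite !intrM => E.
by rewrite mulrAC -E mulfK.
Qed.

(** The kernel modulo [p] has [p] times as many elements as the [p]-torsion; this factor turns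
    [m.+1] into [m]. *)
Lemma num_invariant_factors_forcing (G : sgraph) (d r : G -> int) (Z : {set G}) (m : nat) :
    is_tree G -> arithmetical_structure d r ->
    (forall p, prime p -> forall x : G -> 'F_p, balanced (intr_fun _ d) x ->
       {in Z, forall z, x z = 0} -> forall v, x v = 0) ->
    (#|Z| <= m.+1)%N ->
  (num_invariant_factors (critical_group (laplacian d)) <= m)%N.
Proof.
move=> tG dr ub Zm; apply: num_invariant_factors_le => p p_pr.
rewrite -(leq_pmul2l (prime_gt0 p_pr)) -(card_critical_ptorsion tG dr p_pr) -expnS.
apply: leq_trans (card_kerp_le p_pr (ub p p_pr)) _.
by rewrite leq_exp2l // prime_gt1.
Qed.

Lemma primitive_kernel (G : sgraph) (d r : G -> int) :
    (0 < #|G|)%N -> (forall v, 0 <= d v) -> (forall v, 0 < r v) -> balanced d r ->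
  exists r', arithmetical_structure d r'.
Proof.
move=> /card_gt0P[v0 _] d_ge0 r_gt0 bal_r.
(* Dividing by the gcd of all entries keeps the kernel equation and makes the vector primitive. *)
pose g : nat := \big[gcdn/0%N]_v `|r v|%N.
have g_dvd v : (g %| r v)%Z by rewrite /dvdz /=; apply: (biggcdn_inf v).
have g_neq0 : g%:Z != 0.
  apply: contraTneq (g_dvd v0) => ->; rewrite dvd0z; exact/lt0r_neq0.
have rE v : r v = (r v %/ g)%Z * g by rewrite divzK.
exists (fun v => (r v %/ g)%Z); split=> // [v|c c_dvd|].
- have := r_gt0 v; rewrite {1}rE pmulr_lgt0 //.
  by rewrite lt0r g_neq0.
- have: (`|c| * g %| g)%N.
    apply/dvdn_biggcdP => v _; rewrite rE abszM dvdn_mul //; exact: c_dvd.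
  have g_gt0 : (0 < g)%N by rewrite lt0n; exact: g_neq0.
  by rewrite -{2}[g]mul1n dvdn_pmul2r // dvdn1 => /eqP.
- apply/laplacian_vec => v; apply: (mulIf g_neq0).
  by rewrite -mulrA -rE bal_r mulr_suml; apply: eq_bigr => w _.
Qed.

(** The upper bound uses every prime; the lower bound comes from the prime 2 alone, where the kernel
    has dimension [#|Z|]. *)
Lemma sharp_num_invariant_factors (G : sgraph) (d : G -> int) (Z : {set G}) (t : nat) :
    is_tree G -> sharp d Z -> #|Z| = t.+1 ->
  exists r, arithmetical_structure d r /\
    num_invariant_factors (critical_group (laplacian d)) = t.
Proof.
move=> tG [d_ge0 [r0 r0_gt0 bal_r0] ub lb] Zt; have [G_gt0 _ _] := tG.
have [r dr] := primitive_kernel G_gt0 d_ge0 r0_gt0 bal_r0; exists r; split=> //.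
apply/eqP; rewrite eqn_leq (num_invariant_factors_forcing tG dr ub) ?Zt //=.
apply: (@num_invariant_factors_ge _ 2) => //.
rewrite -(leq_pmul2l (ltn0Sn 1)) -(card_critical_ptorsion tG dr) // -expnS -Zt.
exact: card_kerp_ge lb.
Qed.

Theorem theorem4p5 (T : sgraph) (Ss : seq sgraph)
    (treeT : is_tree T) (T_ge2 : (2 <= #|T|)%N)
    (decT : starlike_decomposition T Ss) :
  (forall d r : T -> int, arithmetical_structure d r ->
     (num_invariant_factors (critical_group (laplacian d)))%:Z
       <= \sum_(S <- Ss) (#|leaves S|%:Z - 2))
  /\
  (forall t : int, 0 <= t -> t <= \sum_(S <- Ss) (#|leaves S|%:Z - 2) ->
     exists d r : T -> int, arithmetical_structure d r /\
       (num_invariant_factors (critical_group (laplacian d)))%:Z = t).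
Proof.
have [m [-> [Z forceZ Zm] sharp_m]] := decomposition_forcing_sharp decT treeT T_ge2.
split=> [d r dr|[t|//] _ t_le].
  rewrite lez_nat; apply: num_invariant_factors_forcing dr _ Zm => // p p_pr x.
  exact: forceZ.
have [d [Z' [sharpZ' cardZ']]] := sharp_m t t_le.
have [r [dr num_t]] := sharp_num_invariant_factors treeT sharpZ' cardZ'.
by exists d, r; rewrite num_t.
Qed.
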